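(* Suppose Assumption (LICQ) stated in the context holds, $\bar r\le r\le n$, and $\{(R_i,y_i)\}_{i\in\mathbb{N}}$ is the (infinite) iteration sequence generated by the rank-support-adaptive algorithm described in the context for solving (SDP). Suppose further that $\mathrm{grad}f_r$ is locally Lipschitz on $\Omega_r$. Moreover, assume that the following conditions hold: (i) $(R_i,y_i)$ converges to some $(0,0)$-stationary point $(R^*,y^* )\in\Omega_r$ that satisfies the $(\alpha,\epsilon)$-quadratic growth condition with parameters $\alpha,\epsilon>0$. (ii) There exists $N\in\mathbb{N}_+$ such that for any $i\ge N$: $\epsilon_i=0$, $(R_i,y_i)\in\Omega_r$, $\mathrm{supp}(y_i)=\mathrm{supp}(y^* )$, and the sufficient descent condition $$f_r(R_{i+1},y_{i+1})-f_r(R_i,y_i)\le-\gamma_g\|\mathrm{grad}f_r(R_i,y_i)\|\min\{1,\|\mathrm{grad}f_r(R_i,y_i)\|\}$$ holds, where $\gamma_g>0$ is a constant independent of $i$. Then $f_r(R_i,y_i)$ converges to $f_r(R^*,y^* )$ R-linearly, i.e. there are $a\ge 0$ and $q\in[0,1)$ with $|f_r(R_i,y_i)-f_r(R^*,y^* )|\le a\,q^i$ for all sufficiently large $i$.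
   Context: Notation: $\mathbb{S}^n$ is the space of real symmetric $n\times n$ matrices with $\langle A,B\rangle=\mathrm{Tr}(AB^\top)$; $\|\cdot\|$ is the Frobenius/Euclidean norm (product norm on pairs); $\circ$ is the entrywise product; $[A;B]$ stacks $A$ above $B$; $\mathrm{diag}(M)$ is the vector of diagonal entries of $M$; square roots of vectors are entrywise; $\mathrm{supp}(y)=\{j:y_j\neq0\}$. Integers $n,m,p,k$ with $0\le k\le n$ are fixed. Data: $\phi:\mathbb{S}^n\times\mathbb{R}^p\to\mathbb{R}$ convex and continuously differentiable, $b\in\mathbb{R}^m$, $\mathcal{K}(X,x)=\mathcal{A}(X)+Bx$ with $B\in\mathbb{R}^{m\times p}$, $\mathcal{A}(X)=(\langle A_i,X\rangle)_{i=1}^m$, $A_i\in\mathbb{S}^n$, $\mathcal{A}^*(\lambda)=\sum_i\lambda_iA_i$. (SDP): minimize $\phi(X,x)$ s.t. $\mathcal{K}(X,x)=b$, $X_{1:k,1:k}=I_k$, $X\in\mathbb{S}^n_+$, $x\in\mathbb{R}^p_+$. For $r\ge k$ let $I_{k,r}=[I_k,0_{k\times(r-k)}]$, $J=[0_{(n-k)\times k},I_{n-k}]$, and $\widehat R=[I_{k,r};R]\in\mathbb{R}^{n\times r}$ for $R\in\mathbb{R}^{(n-k)\times r}$. (SDPR): minimize $f_r(R,y):=\phi(\widehat R\widehat R^\top,y\circ y)$ over $\Omega_r:=\{(R,y)\in\mathbb{R}^{(n-k)\times r}\times\mathbb{R}^p:\mathcal{G}(R,y)=0\}$, $\mathcal{G}(R,y):=\mathcal{K}(\widehat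 R\widehat R^\top,y\circ y)-b$. Derivatives: $\mathrm{D}\mathcal{G}(R,y)[(H,h)]=\mathcal{K}(\mathcal{L}_R(H),2y\circ h)$ with $\mathcal{L}_R(H)=\begin{pmatrix}0 & I_{k,r}H^\top \\ H I_{k,r}^\top & RH^\top+HR^\top\end{pmatrix}$, and $\mathrm{D}\mathcal{G}(R,y)^*[\lambda]=2(J\mathcal{A}^*(\lambda)\widehat R,\ (B^\top\lambda)\circ y)$. LICQ holds at $(R,y)$ iff $\mathrm{D}\mathcal{G}(R,y)^*$ is injective. At a point with LICQ, $\lambda$ denotes the unique solution of $\mathrm{D}\mathcal{G}(R,y)\mathrm{D}\mathcal{G}(R,y)^*[\lambda]=\mathrm{D}\mathcal{G}(R,y)[\nabla f_r(R,y)]$; the tangent space is $\mathrm{T}_{(R,y)}\Omega_r=\ker\mathrm{D}\mathcal{G}(R,y)$; the Riemannian gradient is $\mathrm{grad}f_r(R,y)=\nabla f_r(R,y)-\mathrm{D}\mathcal{G}(R,y)^*[\lambda]$. Write $C=\nabla_X\phi(\widehat R\widehat R^\top,y\circ y)$, $c=\nabla_x\phi(\widehat R\widehat R^\top,y\circ y)$, $C_{22}=JCJ^\top$, $\tilde{\mathcal{A}}^*(\lambda)=J\mathcal{A}^*(\lambda)J^\top$. A retraction at $(R,y)$ is a map $\mathrm{Rtr}_{(R,y)}:\mathrm{T}_{(R,y)}\Omega_r\to\Omega_r$ with $\mathrm{Rtr}_{(R,y)}(t(H,h))=(R,y)+t(H,h)+o(t)$; one is fixed on each $\Omega_r$. Assumption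 (LICQ): there is a positive integer $\bar r\ge k$ such that for every $r\ge\bar r$, $\Omega_r\ne\emptyset$ and LICQ holds at every point of $\Omega_r$. $(0,0)$-stationary point: $(R,y)\in\Omega_r$ with $\mathrm{grad}f_r(R,y)=0$, $C_{22}-\tilde{\mathcal{A}}^*(\lambda)\succeq0$ and $c-B^\top\lambda\ge0$. Quadratic growth: a $(0,0)$-stationary point $(R^*,y^* )\in\Omega_r$ satisfies the $(\alpha,\epsilon)$-quadratic growth condition if $\mathrm{rank}(R^* )=r$ and $\phi(X,x)\ge\phi(X^*,x^* )+\frac{\alpha}{2}(\|X-X^*\|^2+\|x-x^*\|^2)$, where $(X^*,x^* )=(\widehat{R^*}\widehat{R^*}^\top,y^*\circ y^* )$ and $(X,x)=(\widehat R\widehat R^\top,y\circ y)$, for any $(R,y)\in\Omega_r$ with $\mathrm{supp}(y)=\mathrm{supp}(y^* )$ and $\max\{\|R-R^*\|,\|y-y^*\|\}<\epsilon$. Extended set used by the algorithm: for $\tau\in\mathbb{N}_+$, $\Omega_r^\tau:=\{(S,Y)\in\mathbb{R}^{(n-k)\times(r+\tau)}\times\mathbb{R}^{p\times2}:\mathcal{K}(\widehat S\widehat S^\top,\mathrm{diag}(YY^\top))=b\}$, with tangent space $\{(U,V):\mathcal{K}(\mathcal{L}_S(U),2\,\mathrm{diag}(YV^\top))=0\}$ and $f_{r,\tau}(S,Y):=\phi(\widehat S\widehat S^\top,\mathrm{diag}(YY^\top))$; a second-order retraction is fixed on it: $\mathrm{Rtr}_{(S,Y)}(t(U,V))=(S,Y)+t(U,V)+\frac{t^2}{2}(W,Z)+o(t^2)\in\Omega_r^\tau$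 with $(W,Z)$ orthogonal to the tangent space at $(S,Y)$. Algorithm. Parameters: $r_0\in[\bar r,n]$, $\tau\in\mathbb{N}_+$, tolerances $\epsilon_g,\epsilon_h$, nonnegative numbers $\epsilon_i$, constants $\gamma_g,\gamma_h>0$, starting point $(R_0,y_0)\in\Omega_{r_0}$. At iteration $i$, with $(R_i,y_i)\in\Omega_{r_i}$, and with $\lambda_i,C,c$ taken at $(R_i,y_i)$: 1. If $\|\mathrm{grad}f_{r_i}(R_i,y_i)\|\ge\epsilon_g$: choose $t_i\ge0$ such that $f_{r_i}(\mathrm{Rtr}_{(R_i,y_i)}(-t_i\,\mathrm{grad}f_{r_i}(R_i,y_i)))-f_{r_i}(R_i,y_i)\le-\gamma_g\|\mathrm{grad}f_{r_i}(R_i,y_i)\|\min\{1,\|\mathrm{grad}f_{r_i}(R_i,y_i)\|\}$; set $(R_{i+1},y_{i+1})$ equal to the retracted point and $r_i^+=r_i$. 2. Otherwise let $\xi_i$ be the optimal value and $(H_i,h_i)$ a minimizer of $\min\{\langle C_{22}-\tilde{\mathcal{A}}^*(\lambda_i),HH^\top\rangle+\langle c-B^\top\lambda_i,h\circ h\rangle:(H,h)\in\mathbb{R}^{(n-k)\times\tau}\times\mathbb{R}^p,\ \|H\|^2+\|h\|^2=1\}$. If $\max\{-\xi_i,0\}\le\epsilon_h$, return. Else set $(S_i,Y_i)=([R_i,0],[y_i,0])$, $(U_i,V_i)=([0,H_i],[0,h_i])$ (with $\tau$, resp. one, extra columns), choose $t_i$ with $f_{r_i,\tau}(\mathrm{Rtr}_{(S_i,Y_i)}(t_i(U_i,V_i)))-f_{r_i}(R_i,y_i)\le\gamma_h\xi_i\min\{1,\xi_i^2\}$,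 let $(S_{i+1},Y_{i+1})$ be the retracted point, $(R_{i+1},y_{i+1})=(S_{i+1},\sqrt{\mathrm{diag}(Y_{i+1}Y_{i+1}^\top)})$, $r_i^+=r_i+\tau$. 3. If $R_{i+1}$ has more than $n$ columns, replace it by some $R\in\mathbb{R}^{(n-k)\times n}$ with $\widehat R\widehat R^\top=\widehat R_{i+1}\widehat R_{i+1}^\top$ and set $r_i^+=n$. 4. Find $(R',y')\in\Omega_{r'}$ with $\bar r\le r'\le r_i^+$, $\mathrm{supp}(y')\subset\mathrm{supp}(y_{i+1})$ and $f_{r'}(R',y')\le f_{r_i^+}(R_{i+1},y_{i+1})+\epsilon_i$; set $(R_{i+1},y_{i+1})=(R',y')$, $r_{i+1}=r'$. For this asymptotic statement the algorithm is considered run without finite termination (tolerances $\epsilon_g,\epsilon_h$ may be taken to be zero), so that it produces an infinite sequence. *)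

(* Defs.v *)
From HB Require Import structures.
From mathcomp Require Import all_boot all_order all_algebra.
From mathcomp Require Import all_classical all_reals all_analysis.

Import Order.TTheory GRing.Theory Num.Theory.
Import numFieldNormedType.Exports.

Local Open Scope classical_set_scope.
Local Open Scope ring_scope.

Section Euclidean.
Context {R : realType}.

Definition fdot {a b : nat} (M N : 'M[R]_(a, b)) : R := \tr (M *m N^T).
Definition fnorm {a b : nat} (M : 'M[R]_(a, b)) : R := Num.sqrt (fdot M M).

(* The library norm on matrices and pairs is the sup norm (same topology, but
   not the same value), hence these Euclidean ones. *)
Definition pdot {a b c d : nat} (z w : 'M[R]_(a, b) * 'M[R]_(c, d)) : R :=
  fdot z.1 w.1 + fdot z.2 w.2.
Definition pnorm {a b c d : nat} (z : 'M[R]_(a, b) * 'M[R]_(c, d)) : R :=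
  Num.sqrt (pdot z z).

Definition hadamard {a b : nat} (M N : 'M[R]_(a, b)) : 'M[R]_(a, b) :=
  map2_mx *%R M N.

Definition vecdiag {a : nat} (M : 'M[R]_a) : 'cV[R]_a := \col_i M i i.

Definition supp {a : nat} (y : 'cV[R]_a) : {set 'I_a} :=
  [set j | y j 0 != 0]%SET.

Definition nonneg {a : nat} (v : 'cV[R]_a) : Prop := forall j, 0 <= v j 0.

Definition symmetric_mx {a : nat} (M : 'M[R]_a) : Prop := M^T = M.

Definition psd {a : nat} (M : 'M[R]_a) : Prop :=
  symmetric_mx M /\ forall v : 'cV[R]_a, 0 <= (v^T *m M *m v) 0 0.

(* Gradient for the inner product pdot, read off the Fréchet differential. *)
Definition nabla {a b p : nat} (F : 'M[R]_(a, b) * 'cV[R]_p -> R)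
    (z : 'M[R]_(a, b) * 'cV[R]_p) : 'M[R]_(a, b) * 'cV[R]_p :=
  (\matrix_(i, j) 'd (F : _ -> R^o) z (delta_mx i j, 0),
   \col_j 'd (F : _ -> R^o) z (0, delta_mx j 0)).

(* A function on S^a x R^p is given by a function on all pairs of which only
   the values at symmetric matrices are used.  Its differential calculus on
   S^a x R^p is that of its extension by precomposition with the orthogonal
   projection onto symmetric matrices: differentiability of the two is
   equivalent, and the gradient of the extension at a symmetric point is the
   (symmetric) gradient in S^a x R^p. *)
Definition sympart {a : nat} (M : 'M[R]_a) : 'M[R]_a := 2^-1 *: (M + M^T).
Definition symext {a p : nat} (F : 'M[R]_a * 'cV[R]_p -> R)
    (z : 'M[R]_a * 'cV[R]_p) : R := F (sympart z.1, z.2).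

Definition C1_on_sym {a p : nat} (F : 'M[R]_a * 'cV[R]_p -> R) : Prop :=
  (forall z, differentiable (symext F : _ -> R^o) z) /\
  continuous (nabla (symext F)).

Definition convex_on_sym {a p : nat} (F : 'M[R]_a * 'cV[R]_p -> R) : Prop :=
  convex_function (E := ('M[R]_a * 'cV[R]_p)%type)
    [set z | symmetric_mx z.1] F.

End Euclidean.

(* The matrix order is n = k + l, so that l stands for n - k. *)
Record sdp (R : realType) (k l m p : nat) := SDP {
  phi : 'M[R]_(k + l) * 'cV[R]_p -> R;
  Amx : 'I_m -> 'M[R]_(k + l);
  Bmx : 'M[R]_(m, p);
  bvec : 'cV[R]_m }.
Arguments phi {R k l m p} _.
Arguments Amx {R k l m p} _.
Arguments Bmx {R k l m p} _.
Arguments bvec {R k l m p} _.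

Section Problem.
Context {R : realType} {k l m p : nat} (P : sdp R k l m p).

Definition Kop (X : 'M[R]_(k + l)) (x : 'cV[R]_p) : 'cV[R]_m :=
  (\col_i fdot (Amx P i) X) + Bmx P *m x.

Definition Aadj (lam : 'cV[R]_m) : 'M[R]_(k + l) := \sum_i lam i 0 *: Amx P i.

(* For k <= r, pid_mx k : 'M_(k, r) is [I_k, 0]. *)
Definition hat {r : nat} (M : 'M[R]_(l, r)) : 'M[R]_(k + l, r) :=
  col_mx (pid_mx k) M.

Definition gram {r : nat} (M : 'M[R]_(l, r)) : 'M[R]_(k + l) :=
  hat M *m (hat M)^T.

Definition Jmx : 'M[R]_(l, k + l) := row_mx 0 1%:M.

Definition lift_pt {r : nat} (z : 'M[R]_(l, r) * 'cV[R]_p) :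
    'M[R]_(k + l) * 'cV[R]_p := (gram z.1, hadamard z.2 z.2).

Definition fr {r : nat} (z : 'M[R]_(l, r) * 'cV[R]_p) : R := phi P (lift_pt z).

Definition Gmap {r : nat} (z : 'M[R]_(l, r) * 'cV[R]_p) : 'cV[R]_m :=
  Kop (lift_pt z).1 (lift_pt z).2 - bvec P.

Definition Omega (r : nat) : set ('M[R]_(l, r) * 'cV[R]_p) :=
  [set z | Gmap z = 0].

Definition Lmap {r : nat} (M H : 'M[R]_(l, r)) : 'M[R]_(k + l) :=
  block_mx 0 (pid_mx k *m H^T) (H *m (pid_mx k)^T) (M *m H^T + H *m M^T).

(* The differential of Gmap at z, and its adjoint for fdot and pdot (for
   symmetric Amx P i), in closed form. *)
Definition DG {r : nat} (z v : 'M[R]_(l, r) * 'cV[R]_p) : 'cV[R]_m :=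
  Kop (Lmap z.1 v.1) (2 *: hadamard z.2 v.2).

Definition DGadj {r : nat} (z : 'M[R]_(l, r) * 'cV[R]_p) (lam : 'cV[R]_m) :
    'M[R]_(l, r) * 'cV[R]_p :=
  (2 *: (Jmx *m Aadj lam *m hat z.1), 2 *: hadamard ((Bmx P)^T *m lam) z.2).

Definition LICQ {r : nat} (z : 'M[R]_(l, r) * 'cV[R]_p) : Prop :=
  injective (DGadj z).

Definition LICQ_assumption (rbar : nat) : Prop :=
  [/\ (0 < rbar)%N, (k <= rbar)%N &
      forall r, (rbar <= r)%N -> Omega r !=set0 /\ (forall z, Omega r z -> LICQ z)].

(* Under LICQ the set below is a singleton; 0 is only a junk value. *)
Definition lagmult {r : nat} (z : 'M[R]_(l, r) * 'cV[R]_p) : 'cV[R]_m :=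
  xget 0 [set lam | DG z (DGadj z lam) = DG z (nabla fr z)].

Definition tangent {r : nat} (z : 'M[R]_(l, r) * 'cV[R]_p) :
    set ('M[R]_(l, r) * 'cV[R]_p) := [set v | DG z v = 0].

Definition rgrad {r : nat} (z : 'M[R]_(l, r) * 'cV[R]_p) :
    'M[R]_(l, r) * 'cV[R]_p := nabla fr z - DGadj z (lagmult z).

Definition Cmx {r : nat} (z : 'M[R]_(l, r) * 'cV[R]_p) : 'M[R]_(k + l) :=
  (nabla (symext (phi P)) (lift_pt z)).1.
Definition cvec {r : nat} (z : 'M[R]_(l, r) * 'cV[R]_p) : 'cV[R]_p :=
  (nabla (symext (phi P)) (lift_pt z)).2.

(* C_22 - tilde A^*(lambda) and c - B^T lambda. *)
Definition slackM {r : nat} (z : 'M[R]_(l, r) * 'cV[R]_p) : 'M[R]_l :=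
  Jmx *m Cmx z *m Jmx^T - Jmx *m Aadj (lagmult z) *m Jmx^T.
Definition slackv {r : nat} (z : 'M[R]_(l, r) * 'cV[R]_p) : 'cV[R]_p :=
  cvec z - (Bmx P)^T *m lagmult z.

Definition stationary00 {r : nat} (z : 'M[R]_(l, r) * 'cV[R]_p) : Prop :=
  [/\ Omega r z, rgrad z = 0, psd (slackM z) & nonneg (slackv z)].

Definition quadratic_growth {r : nat} (alpha eps : R)
    (zs : 'M[R]_(l, r) * 'cV[R]_p) : Prop :=
  \rank zs.1 = r /\
  forall z : 'M[R]_(l, r) * 'cV[R]_p, Omega r z ->
    supp z.2 = supp zs.2 ->
    Num.max (fnorm (z.1 - zs.1)) (fnorm (z.2 - zs.2)) < eps ->
    fr zs + alpha / 2 * (fnorm ((lift_pt z).1 - (lift_pt zs).1) ^+ 2 +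
                         fnorm ((lift_pt z).2 - (lift_pt zs).2) ^+ 2) <= fr z.

Definition is_retraction {r : nat}
    (rt : 'M[R]_(l, r) * 'cV[R]_p -> 'M[R]_(l, r) * 'cV[R]_p ->
          'M[R]_(l, r) * 'cV[R]_p) : Prop :=
  forall z v, Omega r z -> tangent z v ->
    Omega r (rt z v) /\
    (fun t : R^o => rt z (t *: v) - z - t *: v) =o_ (0 : R^o) (fun t : R^o => t).

Definition lift_ext {r tau : nat} (w : 'M[R]_(l, r + tau) * 'M[R]_(p, 2)) :
    'M[R]_(k + l) * 'cV[R]_p := (gram w.1, vecdiag (w.2 *m w.2^T)).

Definition fext {r tau : nat} (w : 'M[R]_(l, r + tau) * 'M[R]_(p, 2)) : R :=
  phi P (lift_ext w).

Definition Omega_ext (r tau : nat) :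
    set ('M[R]_(l, r + tau) * 'M[R]_(p, 2)) :=
  [set w | Kop (lift_ext w).1 (lift_ext w).2 = bvec P].

Definition tangent_ext {r tau : nat} (w : 'M[R]_(l, r + tau) * 'M[R]_(p, 2)) :
    set ('M[R]_(l, r + tau) * 'M[R]_(p, 2)) :=
  [set u | Kop (Lmap w.1 u.1) (2 *: vecdiag (w.2 *m u.2^T)) = 0].

Definition is_retraction2 {r tau : nat}
    (rt : 'M[R]_(l, r + tau) * 'M[R]_(p, 2) ->
          'M[R]_(l, r + tau) * 'M[R]_(p, 2) ->
          'M[R]_(l, r + tau) * 'M[R]_(p, 2)) : Prop :=
  forall w u, Omega_ext r tau w -> tangent_ext w u ->
    Omega_ext r tau (rt w u) /\
    exists2 q : 'M[R]_(l, r + tau) * 'M[R]_(p, 2),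
      (forall u', tangent_ext w u' -> pdot q u' = 0) &
      (fun t : R^o => rt w (t *: u) - w - t *: u - (t ^+ 2 / 2) *: q)
        =o_ (0 : R^o) (fun t : R^o => t ^+ 2 : R^o).

End Problem.

(* An iterate carries its own number rk of columns. *)
Record iterate (R : realType) (l p : nat) := Iterate {
  rk : nat;
  pt : 'M[R]_(l, rk) * 'cV[R]_p }.
Arguments Iterate {R l p} rk pt.
Arguments rk {R l p} _.
Arguments pt {R l p} _.

(* The pair (R, y) of an iterate seen in R^{l x r} x R^p; a junk value for the
   matrix part when the iterate does not have r columns. *)
Definition at_rank {R : realType} {l p : nat} (r : nat) (z : iterate R l p) :
    'M[R]_(l, r) * 'cV[R]_p := (conform_mx 0 (pt z).1, (pt z).2).

Definition in_Omega {R : realType} {k l m p : nat} (P : sdp R k l m p) (r : nat)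
    (z : iterate R l p) : Prop := rk z = r /\ Omega P r (at_rank r z).

(* rtr and rtr2 take a base point and a tangent vector; their values at other
   arguments are irrelevant. *)
Record params (R : realType) (l p : nat) := Params {
  tau : nat;
  eps_g : R;
  eps_h : R;
  eps_i : nat -> R;
  gamma_g : R;
  gamma_h : R;
  rtr : forall r, 'M[R]_(l, r) * 'cV[R]_p -> 'M[R]_(l, r) * 'cV[R]_p ->
                  'M[R]_(l, r) * 'cV[R]_p;
  rtr2 : forall r, 'M[R]_(l, r + tau) * 'M[R]_(p, 2) ->
                   'M[R]_(l, r + tau) * 'M[R]_(p, 2) ->
                   'M[R]_(l, r + tau) * 'M[R]_(p, 2) }.
Arguments tau {R l p} _.
Arguments eps_g {R l p} _.
Arguments eps_h {R l p} _.
Arguments eps_i {R l p} _.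
Arguments gamma_g {R l p} _.
Arguments gamma_h {R l p} _.
Arguments rtr {R l p} _ {r} _ _.
Arguments rtr2 {R l p} _ {r} _ _.

Section Algorithm.
Context {R : realType} {k l m p : nat}.
Variables (P : sdp R k l m p) (rbar : nat) (prm : params R l p).

Definition params_ok : Prop :=
  [/\ (0 < tau prm)%N, 0 <= eps_g prm, 0 <= eps_h prm &
      forall i, 0 <= eps_i prm i] /\
  [/\ 0 < gamma_g prm, 0 < gamma_h prm,
      forall r, (rbar <= r)%N -> is_retraction P (rtr prm (r := r)) &
      forall r, (rbar <= r)%N -> is_retraction2 P (rtr2 prm (r := r))].

Definition gradient_step (z z1 : iterate R l p) : Prop :=
  let g := rgrad P (pt z) in
  eps_g prm <= pnorm g /\
  exists2 t : R, 0 <= t &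
    let z' := rtr prm (pt z) (- t *: g) in
    fr P z' - fr P (pt z) <= - gamma_g prm * pnorm g * Num.min 1 (pnorm g) /\
    z1 = Iterate (rk z) z'.

Definition curvature (z : iterate R l p)
    (v : 'M[R]_(l, tau prm) * 'cV[R]_p) : R :=
  fdot (slackM P (pt z)) (v.1 *m v.1^T) +
  fdot (slackv P (pt z)) (hadamard v.2 v.2).

Definition curvature_minimizer (z : iterate R l p)
    (v : 'M[R]_(l, tau prm) * 'cV[R]_p) : Prop :=
  fnorm v.1 ^+ 2 + fnorm v.2 ^+ 2 = 1 /\
  forall w : 'M[R]_(l, tau prm) * 'cV[R]_p,
    fnorm w.1 ^+ 2 + fnorm w.2 ^+ 2 = 1 -> curvature z v <= curvature z w.

(* eps_h prm < Num.max (- xi) 0 says that the algorithm does not return here. *)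
Definition escape_step (z z1 : iterate R l p) : Prop :=
  pnorm (rgrad P (pt z)) < eps_g prm /\
  exists v : 'M[R]_(l, tau prm) * 'cV[R]_p,
    let xi := curvature z v in
    [/\ curvature_minimizer z v, eps_h prm < Num.max (- xi) 0 &
    exists t : R,
      let SY : 'M[R]_(l, rk z + tau prm) * 'M[R]_(p, 2) :=
        (row_mx (pt z).1 0, row_mx (pt z).2 (0 : 'cV[R]_p)) in
      let UV : 'M[R]_(l, rk z + tau prm) * 'M[R]_(p, 2) :=
        (row_mx 0 v.1, row_mx (0 : 'cV[R]_p) v.2) in
      let w := rtr2 prm SY (t *: UV) in
      fext P w - fr P (pt z) <= gamma_h prm * xi * Num.min 1 (xi ^+ 2) /\
      z1 = Iterate (rk z + tau prm)
             (w.1, map_mx Num.sqrt (vecdiag (w.2 *m w.2^T)))].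

Definition column_cap (z1 z2 : iterate R l p) : Prop :=
  if (rk z1 <= k + l)%N then z2 = z1
  else exists2 M : 'M[R]_(l, k + l),
    gram (k := k) M = gram (pt z1).1 & z2 = Iterate (k + l) (M, (pt z1).2).

Definition rank_support_step (eps : R) (z2 z' : iterate R l p) : Prop :=
  [/\ Omega P (rk z') (pt z'), (rbar <= rk z' <= rk z2)%N,
      supp (pt z').2 \subset supp (pt z2).2 &
      fr P (pt z') <= fr P (pt z2) + eps].

Definition iteration (eps : R) (z z' : iterate R l p) : Prop :=
  exists z1 z2 : iterate R l p,
    [/\ gradient_step z z1 \/ escape_step z z1, column_cap z1 z2 &
        rank_support_step eps z2 z'].

Definition generated (z : nat -> iterate R l p) : Prop :=
  [/\ (rbar <= rk (z 0%N) <= k + l)%N, Omega P (rk (z 0%N)) (pt (z 0%N)) &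
      forall i, iteration (eps_i prm i) (z i) (z i.+1)].

End Algorithm.

(* Main.v *)
Require Import Defs.
From HB Require Import structures.
From mathcomp Require Import all_boot all_order all_algebra.
From mathcomp Require Import all_classical all_reals all_analysis.
From mathcomp Require Import ring lra.
Import Order.TTheory GRing.Theory Num.Theory.
Import numFieldNormedType.Exports.
Local Open Scope classical_set_scope.
Local Open Scope ring_scope.

(** The theorem is a Polyak-Lojasiewicz argument: near zstar, on the feasible
points with the same support,

    f z - f zstar <= c * |grad f z|^2,

and a step that decreases [f] by at least [gamma * |grad f|^2] then contracts
the gap [f - f zstar] by a factor below one.  The work is in the displayed
inequality, which is [gradient_dominated].

Write (X, x) for the lifted point (gram z.1, z.2 o z.2) and (X0, x0) for the
lift of zstar, E = X - X0, e = x - x0, and S = C - Aadj lambda,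
s = c - B^T lambda at z.  Convexity of phi, and the fact that K takes the same
value at both feasible points, give ([fr_gap_le])

    f z - f zstar <= <S, E> + <s, e>.

The gradient is grad f z = 2 (J S hat z.1, s o z.2), so one wants to bound
<S, E> and <s, e> by |grad f z| times |(E, e)|, up to a small multiple of
|(E, e)|^2.  Quadratic growth bounds |(E, e)|^2 by the gap itself, and Young's
inequality then finishes the estimate.

For the vector part this is immediate: the supports agree, so on the support s
is obtained by dividing the gradient by 2 z.2, which stays away from zero
([fdot_square_bound]).

For the matrix part split the columns of R = z.1 into the k columns A that face
the identity block and the remaining ones B.  The block A is itself a block of
X, so it is controlled by E.  The block B enters only through B B^T and is
determined up to an orthogonal factor; instead of aligning the two factors one
splits F = B B^T - B0 B0^T along an oblique projection 1 - B L, where L is a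
left inverse of B bounded uniformly near zstar (this is where the full column
rank at zstar is used).  Two of the pieces contain S22 B, hence the gradient;
the last one is - <S22, W W^T> with W = (1 - B L) B0 of size O(|F|), and S22, the
lower right block of S, is close to the positive semidefinite slack matrix at
zstar, so that it contributes at most o(|F|^2) ([fdot_gram_bound],
[fdot_slack_bound]).

Closeness of the slack matrices requires the multiplier to be continuous at
zstar along points whose gradient tends to zero.  LICQ makes DGadj zstar bounded
below, and the two stationarity equations, exact at zstar and approximate at z,
bound DGadj zstar (lambda - lambda0)
([lagmult_near], [slackM_near]).  Along the sequence the gradients do tend to
zero: the values converge, so the sufficient decrease does too. *)

(** * Frobenius norm *)

Section Frobenius.
Context {R : realType}.

Lemma fdotE {a b : nat} (M N : 'M[R]_(a, b)) :
  fdot M N = \sum_i \sum_j M i j * N i j.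
Proof.
rewrite /fdot /mxtrace; apply: eq_bigr => i _; rewrite mxE.
by apply: eq_bigr => j _; rewrite mxE.
Qed.

Lemma fdotC {a b : nat} (M N : 'M[R]_(a, b)) : fdot M N = fdot N M.
Proof. by rewrite /fdot -mxtrace_tr trmx_mul trmxK. Qed.

Lemma fdotDl {a b : nat} (M N Q : 'M[R]_(a, b)) :
  fdot (M + N) Q = fdot M Q + fdot N Q.
Proof. by rewrite /fdot mulmxDl mxtraceD. Qed.

Lemma fdotZl {a b : nat} t (M N : 'M[R]_(a, b)) :
  fdot (t *: M) N = t * fdot M N.
Proof. by rewrite /fdot -scalemxAl mxtraceZ. Qed.

Lemma fdotNl {a b : nat} (M N : 'M[R]_(a, b)) : fdot (- M) N = - fdot M N.
Proof. by rewrite -scaleN1r fdotZl mulN1r. Qed.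

Lemma fdotBl {a b : nat} (M N Q : 'M[R]_(a, b)) :
  fdot (M - N) Q = fdot M Q - fdot N Q.
Proof. by rewrite fdotDl fdotNl. Qed.

Lemma fdotDr {a b : nat} (M N Q : 'M[R]_(a, b)) :
  fdot Q (M + N) = fdot Q M + fdot Q N.
Proof. by rewrite fdotC fdotDl !(fdotC Q). Qed.

Lemma fdotZr {a b : nat} t (M N : 'M[R]_(a, b)) :
  fdot M (t *: N) = t * fdot M N.
Proof. by rewrite fdotC fdotZl fdotC. Qed.

Lemma fdotNr {a b : nat} (M N : 'M[R]_(a, b)) : fdot M (- N) = - fdot M N.
Proof. by rewrite fdotC fdotNl fdotC. Qed.

Lemma fdotBr {a b : nat} (M N Q : 'M[R]_(a, b)) :
  fdot Q (M - N) = fdot Q M - fdot Q N.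
Proof. by rewrite fdotDr fdotNr. Qed.

Lemma fdot0r {a b : nat} (M : 'M[R]_(a, b)) : fdot M 0 = 0.
Proof. by rewrite /fdot trmx0 mulmx0 mxtrace0. Qed.

Lemma fdot_tr {a b : nat} (M N : 'M[R]_(a, b)) : fdot M^T N^T = fdot M N.
Proof. by rewrite /fdot trmxK mxtrace_mulC -mxtrace_tr trmx_mul trmxK. Qed.

Lemma fdot_mull {a b c : nat} (M : 'M[R]_(a, b)) (N : 'M[R]_(b, c)) Q :
  fdot Q (M *m N) = fdot (M^T *m Q) N.
Proof. by rewrite /fdot trmx_mul mulmxA mxtrace_mulC mulmxA. Qed.

Lemma fdot_mulr {a b c : nat} (M : 'M[R]_(a, b)) (N : 'M[R]_(b, c)) Q :
  fdot Q (M *m N) = fdot (Q *m N^T) M.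
Proof. by rewrite /fdot trmx_mul mulmxA. Qed.

Lemma fdot_row_mx {a b c : nat} (M N : 'M[R]_(a, b)) (M' N' : 'M[R]_(a, c)) :
  fdot (row_mx M M') (row_mx N N') = fdot M N + fdot M' N'.
Proof. by rewrite /fdot tr_row_mx mul_row_col mxtraceD. Qed.

Lemma fdot_col_mx {a b c : nat} (M N : 'M[R]_(a, b)) (M' N' : 'M[R]_(c, b)) :
  fdot (col_mx M M') (col_mx N N') = fdot M N + fdot M' N'.
Proof. by rewrite -fdot_tr !tr_col_mx fdot_row_mx !fdot_tr. Qed.

Lemma fdot_delta {a b : nat} (M : 'M[R]_(a, b)) i j :
  fdot M (delta_mx i j) = M i j.
Proof.
rewrite fdotE (bigD1 i) //= (bigD1 j) //= mxE !eqxx mulr1.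
rewrite !big1 ?addr0// => [i' /negPf ni|j' /negPf nj].
  by apply: big1 => j' _; rewrite mxE ni mulr0.
by rewrite mxE nj andbF mulr0.
Qed.

Lemma fdot_ge0 {a b : nat} (M : 'M[R]_(a, b)) : 0 <= fdot M M.
Proof.
rewrite fdotE !sumr_ge0// => i _; rewrite sumr_ge0// => j _.
exact: sqr_ge0.
Qed.

Lemma fnorm_ge0 {a b : nat} (M : 'M[R]_(a, b)) : 0 <= fnorm M.
Proof. exact: sqrtr_ge0. Qed.
Hint Resolve fnorm_ge0 : core.

Lemma fnorm_sqr {a b : nat} (M : 'M[R]_(a, b)) : fnorm M ^+ 2 = fdot M M.
Proof. by rewrite sqr_sqrtr// fdot_ge0. Qed.

Lemma entry_le_fnorm {a b : nat} (M : 'M[R]_(a, b)) i j :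
  `|M i j| <= fnorm M.
Proof.
rewrite -ler_sqr ?nnegrE// fnorm_sqr fdotE (bigD1 i) //= (bigD1 j) //=.
rewrite real_normK ?num_real// -expr2 -addrA lerDl addr_ge0//.
  by rewrite sumr_ge0// => j' _; apply: sqr_ge0.
by rewrite sumr_ge0// => i' _; rewrite sumr_ge0// => j' _; apply: sqr_ge0.
Qed.

Lemma fnorm_eq0 {a b : nat} (M : 'M[R]_(a, b)) : fnorm M = 0 -> M = 0.
Proof.
move=> M0; apply/matrixP => i j; rewrite mxE; apply/eqP.
by rewrite -normr_le0 -M0 entry_le_fnorm.
Qed.

Lemma fnorm0 {a b : nat} : fnorm (0 : 'M[R]_(a, b)) = 0.
Proof. by rewrite /fnorm /fdot mul0mx mxtrace0 sqrtr0. Qed.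

Lemma fnormZ {a b : nat} t (M : 'M[R]_(a, b)) : fnorm (t *: M) = `|t| * fnorm M.
Proof.
by rewrite /fnorm fdotZl fdotZr mulrA -expr2 sqrtrM ?sqr_ge0// sqrtr_sqr.
Qed.

Lemma fnormN {a b : nat} (M : 'M[R]_(a, b)) : fnorm (- M) = fnorm M.
Proof. by rewrite -scaleN1r fnormZ normrN1 mul1r. Qed.

Lemma fnormBC {a b : nat} (M N : 'M[R]_(a, b)) : fnorm (M - N) = fnorm (N - M).
Proof. by rewrite -fnormN opprB. Qed.

Lemma fnorm_tr {a b : nat} (M : 'M[R]_(a, b)) : fnorm M^T = fnorm M.
Proof. by rewrite /fnorm fdot_tr. Qed.

Lemma fdot_le_fnorm {a b : nat} (M N : 'M[R]_(a, b)) :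
  fdot M N <= fnorm M * fnorm N.
Proof.
have [N0|Nn0] := eqVneq (fnorm N) 0.
  by rewrite (fnorm_eq0 _ N0) fnorm0 mulr0 /fdot trmx0 mulmx0 mxtrace0.
have N0 : 0 < fnorm N by rewrite lt_def Nn0 fnorm_ge0.
have [M0|Mn0] := eqVneq (fnorm M) 0.
  by rewrite (fnorm_eq0 _ M0) fnorm0 mul0r /fdot mul0mx mxtrace0.
have M0 : 0 < fnorm M by rewrite lt_def Mn0 fnorm_ge0.
have := fdot_ge0 (fnorm N *: M - fnorm M *: N).
rewrite !(fdotBl, fdotBr, fdotZl, fdotZr) -!fnorm_sqr (fdotC N M) => H.
have : 0 <= 2 * (fnorm M * fnorm N) * (fnorm M * fnorm N - fdot M N) by lra.
by rewrite pmulr_rge0 ?subr_ge0// !mulr_gt0.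
Qed.

Lemma fdot_ge_fnorm {a b : nat} (M N : 'M[R]_(a, b)) :
  - (fnorm M * fnorm N) <= fdot M N.
Proof. by rewrite lerNl -fdotNl -(fnormN M) fdot_le_fnorm. Qed.

Lemma fnormD {a b : nat} (M N : 'M[R]_(a, b)) :
  fnorm (M + N) <= fnorm M + fnorm N.
Proof.
rewrite -ler_sqr ?nnegrE ?addr_ge0// fnorm_sqr sqrrD !fnorm_sqr.
rewrite !(fdotDl, fdotDr) (fdotC N M).
by move: (fdot_le_fnorm M N); lra.
Qed.

Lemma fnormB {a b : nat} (M N : 'M[R]_(a, b)) :
  fnorm (M - N) <= fnorm M + fnorm N.
Proof. by rewrite -(fnormN N) fnormD. Qed.

Lemma fnorm_sum {a b n : nat} (F : 'I_n -> 'M[R]_(a, b)) :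
  fnorm (\sum_i F i) <= \sum_i fnorm (F i).
Proof.
elim/big_ind2: _ => [|M x N y Mx Ny|//]; first by rewrite fnorm0.
exact: le_trans (fnormD _ _) (lerD Mx Ny).
Qed.

Lemma fnormM {a b c : nat} (M : 'M[R]_(a, b)) (N : 'M[R]_(b, c)) :
  fnorm (M *m N) <= fnorm M * fnorm N.
Proof.
have rowE (n q : nat) (Q : 'M[R]_(n, q)) : fnorm Q ^+ 2 = \sum_h fnorm (row h Q) ^+ 2.
  rewrite fnorm_sqr fdotE; apply: eq_bigr => h _; rewrite fnorm_sqr fdotE big_ord1.
  by apply: eq_bigr => u _; rewrite mxE.
rewrite -ler_sqr ?nnegrE ?mulr_ge0// exprMn fnorm_sqr -(fnorm_tr N) !rowE fdotE.
rewrite mulr_suml; apply: ler_sum => i _.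
rewrite mulr_sumr; apply: ler_sum => j _.
have -> : (M *m N) i j = fdot (row i M) (row j N^T).
  by rewrite fdotE big_ord1 mxE; apply: eq_bigr => u _; rewrite !mxE.
rewrite -exprMn -subr_ge0.
set x := fdot _ _; set y := _ * _.
have -> : y ^+ 2 - x * x = (y - x) * (y - - x) by ring.
by rewrite mulr_ge0// subr_ge0 ?fdot_le_fnorm// lerNl fdot_ge_fnorm.
Qed.

(** Comparison with the entries is what links the Frobenius norm to the topology,
which is that of the sup norm. *)
Lemma fnorm_entrywise {a b : nat} (M : 'M[R]_(a, b)) :
  fnorm M <= \sum_i \sum_j `|M i j|.
Proof.
rewrite {1}[M]matrix_sum_delta.
apply: le_trans (fnorm_sum _) _; apply: ler_sum => i _.
apply: le_trans (fnorm_sum _) _; apply: ler_sum => j _.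
rewrite fnormZ ler_piMr// /fnorm fdot_delta mxE !eqxx sqrtr1.
by [].
Qed.

Lemma fnorm_le_norm {a b : nat} (M : 'M[R]_(a, b)) : fnorm M <= (a * b)%:R * `|M|.
Proof.
apply: le_trans (fnorm_entrywise M) _.
have Mij i j : `|M i j| <= `|M|.
  rewrite [`|M|]mx_normrE.
  exact: (le_bigmax _ (fun ij : 'I_a * 'I_b => `|M ij.1 ij.2|) (i, j)).
apply: le_trans (_ : \sum_(i < a) \sum_(j < b) `|M| <= _); last first.
  by rewrite !sumr_const !card_ord -mulrnA mulr_natl mulnC.
by apply: ler_sum => i _; apply: ler_sum.
Qed.

Lemma fnorm_row_mx {a b c : nat} (M : 'M[R]_(a, b)) (N : 'M[R]_(a, c)) :
  fnorm (row_mx M N) ^+ 2 = fnorm M ^+ 2 + fnorm N ^+ 2.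
Proof. by rewrite !fnorm_sqr fdot_row_mx. Qed.

Lemma fnorm_col_mx {a b c : nat} (M : 'M[R]_(a, b)) (N : 'M[R]_(c, b)) :
  fnorm (col_mx M N) ^+ 2 = fnorm M ^+ 2 + fnorm N ^+ 2.
Proof. by rewrite !fnorm_sqr fdot_col_mx. Qed.

Lemma fnorm_fst_le_pnorm {a b c d : nat} (z : 'M[R]_(a, b) * 'M[R]_(c, d)) :
  fnorm z.1 <= pnorm z.
Proof. by rewrite ler_sqrt ?addr_ge0 ?fdot_ge0// lerDl fdot_ge0. Qed.

Lemma fnorm_snd_le_pnorm {a b c d : nat} (z : 'M[R]_(a, b) * 'M[R]_(c, d)) :
  fnorm z.2 <= pnorm z.
Proof. by rewrite ler_sqrt ?addr_ge0 ?fdot_ge0// lerDr fdot_ge0. Qed.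

Lemma near_fnorm {a b : nat} (M : 'M[R]_(a, b)) e : 0 < e ->
  \forall N \near M, fnorm (N - M) < e.
Proof.
move=> e0.
have d0 : 0 < e / ((a * b)%:R + 1) by rewrite divr_gt0// ltr_wpDl.
near=> N.
apply: le_lt_trans (fnorm_le_norm _) _.
have NM : `|N - M| < e / ((a * b)%:R + 1).
  by near: N; apply: cvgr_distC_lt d0; exact: cvg_id.
apply: (@le_lt_trans _ _ (((a * b)%:R + 1) * `|N - M|)).
  by rewrite ler_wpM2r// lerDl.
by rewrite mulrC -ltr_pdivlMr// ltr_wpDl.
Unshelve. all: by end_near. Qed.

Lemma fnorm_lt_cvg {T : Type} (F : set_system T) {FF : Filter F} {a b : nat}
    (f : T -> 'M[R]_(a, b)) (M : 'M[R]_(a, b)) :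
  f @ F --> M -> forall e, 0 < e -> \forall x \near F, fnorm (f x - M) < e.
Proof. by move=> fM e e0; exact: (fM _ (near_fnorm M e e0)). Qed.

End Frobenius.
#[export] Hint Resolve fnorm_ge0 : core.

(** * Differences of two Gram matrices *)

Section GramBounds.
Context {R : realType}.

Lemma half_bound (u v : R) : u <= v + u * 2^-1 -> u <= 2 * v.
Proof. by lra. Qed.

(** [K *m B] is within 1/2 of the identity, so it is invertible and its inverse has
norm at most twice that of the identity; [(K *m B)^-1 *m K] is the left inverse. *)
Lemma left_inverse_perturbation {l s : nat} (B0 : 'M[R]_(l, s)) (K : 'M[R]_(s, l)) :
  K *m B0 = 1%:M ->
  exists d c : R, [/\ 0 < d, 0 <= c & forall B, fnorm (B - B0) < d ->
    exists2 L : 'M[R]_(s, l), L *m B = 1%:M & fnorm L <= c].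
Proof.
move=> KB0; have K1 : 0 < 2 * (fnorm K + 1) by rewrite mulr_gt0 ?ltr_wpDl ?fnorm_ge0.
exists (2 * (fnorm K + 1))^-1, (2 * fnorm (1%:M : 'M[R]_s) * fnorm K).
split; [by rewrite invr_gt0 | by rewrite !mulr_ge0 ?fnorm_ge0 |move=> B hB].
pose V := K *m (B0 - B).
have KBE : K *m B = 1%:M - V by rewrite /V mulmxBr KB0 opprB addrCA subrr addr0.
have V2 : fnorm V <= 2^-1.
  apply: le_trans (fnormM _ _) _; rewrite fnormBC.
  apply: (@le_trans _ _ ((fnorm K + 1) * (2 * (fnorm K + 1))^-1)).
    by rewrite ler_pM ?fnorm_ge0 ?lerDl// ltW.
  by rewrite invfM mulrCA mulfV ?mulr1// gt_eqF ?ltr_wpDl ?fnorm_ge0.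
have unitKB : K *m B \in unitmx.
  rewrite -row_free_unit -kermx_eq0; apply/eqP/fnorm_eq0/le_anti.
  set v := kermx _; have : v *m (K *m B) = 0 by exact: mulmx_ker.
  rewrite KBE mulmxBr mulmx1 => /eqP; rewrite subr_eq0 => /eqP vE.
  rewrite fnorm_ge0 andbT -[leRHS](mulr0 2); apply: half_bound.
  rewrite add0r {1}vE; apply: le_trans (fnormM _ _) _.
  by rewrite ler_wpM2l ?fnorm_ge0.
exists (invmx (K *m B) *m K); first by rewrite -mulmxA mulVmx.
apply: le_trans (fnormM _ _) _; rewrite ler_wpM2r ?fnorm_ge0//.
apply: half_bound.
have {1}-> : invmx (K *m B) = 1%:M + V *m invmx (K *m B).
  rewrite -{1}[V](subKr 1%:M) -KBE mulmxBl mul1mx mulmxV//.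
  by rewrite addrC subrK.
apply: le_trans (fnormD _ _) _; rewrite lerD2l.
by apply: le_trans (fnormM _ _) _; rewrite mulrC ler_wpM2l ?fnorm_ge0.
Qed.

Lemma fdot_psd_gram {l q : nat} (S : 'M[R]_l) (W : 'M[R]_(l, q)) :
  psd S -> 0 <= fdot S (W *m W^T).
Proof.
move=> [_ S0]; rewrite /fdot trmx_mul trmxK mulmxA mxtrace_mulC /mxtrace.
rewrite sumr_ge0// => i _.
have := S0 (col i W); rewrite (_ : _ 0 0 = (W^T *m (S *m W)) i i) //.
rewrite -mulmxA !mxE; apply: eq_bigr => j _; rewrite !mxE; congr (_ * _).
by apply: eq_bigr => h _; rewrite mxE.
Qed.

(** Decompose [F] along the oblique projection [N] that kills [B]; only the part
[N *m F *m N^T] is not paired with [S *m B], and it is minus a Gram matrix. *)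
Lemma fdot_gram_split {l s : nat} (S : 'M[R]_l) (B B0 : 'M[R]_(l, s))
    (L : 'M[R]_(s, l)) :
  S^T = S -> L *m B = 1%:M ->
  let F := B *m B^T - B0 *m B0^T in
  let N := 1%:M - B *m L in
  fdot S F = fdot (S *m B) (L *m F)^T + fdot (S *m B) (N *m F *m L^T)
             - fdot S ((N *m B0) *m (N *m B0)^T).
Proof.
move=> SS LB F N.
have FT : F^T = F by rewrite /F linearB /= !trmx_mul !trmxK.
have NB : N *m B = 0 by rewrite /N mulmxBl mul1mx -mulmxA LB mulmx1 subrr.
have NFN : N *m F *m N^T = - ((N *m B0) *m (N *m B0)^T).
  rewrite /F mulmxBr mulmxA NB mul0mx sub0r mulNmx trmx_mul !mulmxA.
  by [].
have {1}-> : F = B *m (L *m F) + (N *m F *m L^T) *m B^T + N *m F *m N^T.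
  rewrite -addrA -mulmxA -trmx_mul -mulmxDr -linearD /= /N subrKC trmx1 mulmx1.
  by rewrite mulmxBl mul1mx mulmxA addrC subrK.
rewrite !fdotDr NFN fdotNr; congr (_ + _ - _).
  by rewrite fdot_mull -fdot_tr trmx_mul trmxK SS.
by rewrite fdot_mulr trmxK.
Qed.

(** The term without [S *m B] in the splitting is [- S] paired with the Gram matrix
of [W = N *m B0].  Since [N *m B = 0], [W] equals [- N *m F *m K^T], hence is of
the order of [F], and the near-positivity of [S] makes the term quadratic with
a factor [eta]. *)
Lemma fdot_gram_bound {l s : nat} (B0 : 'M[R]_(l, s)) (K : 'M[R]_(s, l)) :
  K *m B0 = 1%:M ->
  exists d c : R, [/\ 0 < d, 0 <= c & forall B, fnorm (B - B0) < d ->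
    forall (S : 'M[R]_l) (eta : R), S^T = S -> 0 <= eta ->
    (forall W : 'M[R]_(l, s), - (eta * fnorm W ^+ 2) <= fdot S (W *m W^T)) ->
    forall F, F = B *m B^T - B0 *m B0^T ->
    fdot S F <= c * (fnorm (S *m B) * fnorm F + eta * fnorm F ^+ 2)].
Proof.
move=> KB0; have [d [c [d0 c0 HL]]] := left_inverse_perturbation B0 K KB0.
pose n1 := fnorm (1%:M : 'M[R]_l) + (fnorm B0 + d) * c.
have n10 : 0 <= n1 by rewrite !(addr_ge0, mulr_ge0, fnorm_ge0) ?(ltW d0).
exists d, (c + n1 * c + (n1 * fnorm K) ^+ 2).
split=> //; first by rewrite addr_ge0 ?sqr_ge0// addr_ge0// mulr_ge0.
move=> B hB S eta SS eta0 hS F FE; have [L LB Lc] := HL B hB.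
have := fdot_gram_split S B B0 L SS LB; rewrite /= -FE => ->.
set N := 1%:M - B *m L.
have Nn1 : fnorm N <= n1.
  apply: le_trans (fnormB _ _) _; rewrite lerD2l.
  apply: le_trans (fnormM _ _) _; rewrite ler_pM ?fnorm_ge0//.
  rewrite -[B](subrKC B0); apply: le_trans (fnormD _ _) _.
  by rewrite lerD2l ltW.
have NB : N *m B = 0 by rewrite /N mulmxBl mul1mx -mulmxA LB mulmx1 subrr.
have WE : N *m B0 = - (N *m F *m K^T).
  rewrite FE mulmxBr mulmxA NB mul0mx sub0r mulNmx opprK -!mulmxA -trmx_mul KB0.
  by rewrite trmx1 mulmx1.
have W1 : fnorm (N *m B0) <= n1 * fnorm K * fnorm F.
  rewrite WE fnormN mulrAC; apply: le_trans (fnormM _ _) _.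
  rewrite fnorm_tr ler_wpM2r ?fnorm_ge0//; apply: le_trans (fnormM _ _) _.
  by rewrite ler_wpM2r ?fnorm_ge0.
have T1 : fdot (S *m B) (L *m F)^T <= fnorm (S *m B) * (c * fnorm F).
  apply: le_trans (fdot_le_fnorm _ _) _; rewrite ler_wpM2l ?fnorm_ge0// fnorm_tr.
  by apply: le_trans (fnormM _ _) _; rewrite ler_wpM2r ?fnorm_ge0.
have T2 : fdot (S *m B) (N *m F *m L^T) <= fnorm (S *m B) * (n1 * fnorm F * c).
  apply: le_trans (fdot_le_fnorm _ _) _; rewrite ler_wpM2l ?fnorm_ge0//.
  apply: le_trans (fnormM _ _) _; rewrite fnorm_tr ler_pM ?fnorm_ge0//.
  by apply: le_trans (fnormM _ _) _; rewrite ler_wpM2r ?fnorm_ge0.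
have T3 := hS (N *m B0).
have T4 : eta * fnorm (N *m B0) ^+ 2 <= eta * (n1 * fnorm K * fnorm F) ^+ 2.
  by rewrite ler_wpM2l// lerXn2r// ?nnegrE ?mulr_ge0 ?fnorm_ge0.
have T5 : 0 <= (n1 * fnorm K) ^+ 2 * (fnorm (S *m B) * fnorm F).
  by rewrite !mulr_ge0 ?fnorm_ge0.
have T6 : 0 <= (c + n1 * c) * (eta * fnorm F ^+ 2).
  by rewrite !mulr_ge0 ?addr_ge0 ?mulr_ge0 ?fnorm_ge0.
by move: T1 T2 T3 T4 T5 T6; lra.
Qed.

(** On the common support the entries of [y] stay away from zero, so [s] is
recovered from [hadamard s y] by a bounded division.  Entries outside the
support drop out because the corresponding entries of [e] vanish. *)
Lemma fdot_square_bound {p : nat} (y0 : 'cV[R]_p) :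
  exists d c : R, [/\ 0 < d, 0 <= c & forall y, fnorm (y - y0) < d ->
    supp y = supp y0 -> forall s : 'cV[R]_p,
    forall e, e = hadamard y y - hadamard y0 y0 ->
    fdot s e <= c * (fnorm (hadamard s y) * fnorm e)].
Proof.
(* The zero entries of [y0] contribute nothing, as [0^-1 = 0]. *)
pose c := 1 + \sum_j 2 * `|y0 j 0|^-1.
have c1 : 1 <= c by rewrite lerDl sumr_ge0// => j _; rewrite mulr_ge0.
have cj j : 2 * `|y0 j 0|^-1 <= c.
  rewrite /c (bigD1 j) //= addrCA lerDl addr_ge0//.
  by apply: sumr_ge0 => i _; rewrite mulr_ge0.
have c0 : 0 < c by exact: lt_le_trans c1.
exists c^-1, c; split; [by rewrite invr_gt0 | exact: ltW |].
move=> y hy sy s e eE.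
have nz j : (y j 0 != 0) = (y0 j 0 != 0).
  by have /setP/(_ j) := sy; rewrite !inE.
have yc j : `|(y j 0)^-1| <= c.
  have [yj|] := eqVneq (y j 0) 0; first by rewrite yj invr0 normr0 ltW.
  rewrite nz => y0j.
  have y0p : 0 < `|y0 j 0| by rewrite normr_gt0.
  have hj : `|y j 0 - y0 j 0| < `|y0 j 0| / 2.
    have := entry_le_fnorm (y - y0) j 0; rewrite !mxE => /le_lt_trans; apply.
    apply: lt_le_trans hy _; rewrite -[leRHS]invrK lef_pV2 ?posrE ?invr_gt0 ?divr_gt0//.
    by rewrite invf_div.
  have hy2 : `|y0 j 0| / 2 <= `|y j 0|.
    have := ler_normD (y j 0) (y0 j 0 - y j 0); rewrite subrKC (distrC (y0 j 0)).
    move: hj; set u := `|y0 j 0|; set v := `|y j 0 - _|; set w := `|y j 0|.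
    by lra.
  apply: le_trans (cj j); rewrite normfV -invf_div lef_pV2 ?posrE ?divr_gt0//.
  by apply: lt_le_trans hy2; rewrite divr_gt0.
pose u : 'cV[R]_p := \col_j ((y j 0)^-1 * e j 0).
have -> : fdot s e = fdot (hadamard s y) u.
  rewrite !fdotE; apply: eq_bigr => j _; rewrite !big_ord1 !mxE.
  have [yj|yj] := eqVneq (y j 0) 0; last by rewrite -mulrA mulVKf.
  have /eqP y0j : y0 j 0 == 0 by have := nz j; rewrite yj eqxx => /esym/negbFE.
  by rewrite eE !mxE yj y0j !mulr0 subrr !mulr0.
apply: le_trans (fdot_le_fnorm _ _) _; rewrite mulrCA ler_wpM2l ?fnorm_ge0//.
rewrite -ler_sqr ?nnegrE ?mulr_ge0 ?fnorm_ge0 ?(ltW c0)// exprMn !fnorm_sqr !fdotE.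
rewrite mulr_sumr; apply: ler_sum => j _; rewrite !big_ord1 mxE.
rewrite mulrACA -!expr2 ler_wpM2r ?sqr_ge0//.
by rewrite -real_normK ?num_real// lerXn2r ?nnegrE// ltW.
Qed.

End GramBounds.

(** * The slack matrix paired with a difference of lifted points *)

Section SlackBound.
Context {R : realType}.

Lemma fdot_block_mx {a b c d : nat} (M M' : 'M[R]_(a, c)) (N N' : 'M[R]_(a, d))
    (Q Q' : 'M[R]_(b, c)) (T T' : 'M[R]_(b, d)) :
  fdot (block_mx M N Q T) (block_mx M' N' Q' T') =
  fdot M M' + fdot N N' + (fdot Q Q' + fdot T T').
Proof. by rewrite !block_mxEv fdot_col_mx !fdot_row_mx. Qed.

Lemma fnorm_lsub {a b c : nat} (M : 'M[R]_(a, b)) (N : 'M[R]_(a, c)) :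
  fnorm M <= fnorm (row_mx M N).
Proof.
by rewrite -ler_sqr ?nnegrE ?fnorm_ge0// fnorm_row_mx lerDl sqr_ge0.
Qed.

Lemma fnorm_rsub {a b c : nat} (M : 'M[R]_(a, b)) (N : 'M[R]_(a, c)) :
  fnorm N <= fnorm (row_mx M N).
Proof.
by rewrite -ler_sqr ?nnegrE ?fnorm_ge0// fnorm_row_mx lerDr sqr_ge0.
Qed.

Lemma fnorm_dsub {a b c : nat} (M : 'M[R]_(a, b)) (N : 'M[R]_(c, b)) :
  fnorm N <= fnorm (col_mx M N).
Proof. by rewrite -fnorm_tr -[leRHS]fnorm_tr tr_col_mx fnorm_rsub. Qed.

Lemma gram_block {k l s : nat} (A : 'M[R]_(l, k)) (B : 'M[R]_(l, s)) :
  gram (row_mx A B) = block_mx 1%:M A^T A (A *m A^T + B *m B^T).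
Proof.
rewrite /gram /hat pid_mx_row tr_col_mx mul_col_row tr_row_mx mul_row_col.
rewrite !tr_row_mx !mul_row_col.
by rewrite !(trmx1, trmx0, mulmx1, mul1mx, mulmx0, mul0mx, addr0).
Qed.

Lemma Jmx_mul_block {k l s : nat} (S11 : 'M[R]_k) (S12 : 'M[R]_(k, l))
    (S21 : 'M[R]_(l, k)) (S22 : 'M[R]_l) (A : 'M[R]_(l, k)) (B : 'M[R]_(l, s)) :
  Jmx *m block_mx S11 S12 S21 S22 *m hat (row_mx A B) =
  row_mx (S21 + S22 *m A) (S22 *m B).
Proof.
rewrite /Jmx mul_row_block !mul0mx !mul1mx !add0r /hat pid_mx_row mul_row_col.
by rewrite !mul_mx_row mulmx1 mulmx0 add_row_mx add0r.
Qed.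

Lemma Jmx_conj_block {k l : nat} (S11 : 'M[R]_k) (S12 : 'M[R]_(k, l))
    (S21 : 'M[R]_(l, k)) (S22 : 'M[R]_l) :
  Jmx *m block_mx S11 S12 S21 S22 *m Jmx^T = S22.
Proof.
rewrite /Jmx mul_row_block !mul0mx !mul1mx !add0r tr_row_mx mul_row_col.
by rewrite trmx0 trmx1 mulmx0 mulmx1 add0r.
Qed.

Lemma fdot_symmetric_expand {l q : nat} (S F : 'M[R]_l) (A D : 'M[R]_(l, q)) :
  S^T = S ->
  fdot S (F + A *m D^T + D *m A^T - D *m D^T) =
  fdot S F + 2 * fdot (S *m A) D - fdot S (D *m D^T).
Proof.
move=> SS; rewrite !fdotDr fdotNr (fdot_mulr D A^T) trmxK.
rewrite (fdot_mull A) -(fdot_tr (A^T *m S)) trmx_mul !trmxK SS.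
by lra.
Qed.

(** With the columns split as [row_mx A B], the upper left block of [E] vanishes, its
lower left block is [D = A - A0], and the lower right block of [S] acts on
[A *m A^T - A0 *m A0^T] and on [F].  Eliminating the lower left block of [S]
in favour of [Qa] cancels the terms linear in [D] that [Qa] does not control and
leaves only
[2 <Qa, D> - <S22, D D^T> + <S22, F>]. *)
Lemma fdot_slack_bound {k l r : nat} (kr : (k <= r)%N) (R0 : 'M[R]_(l, r)) :
  \rank R0 = r ->
  exists d c : R, [/\ 0 < d, 0 <= c & forall M, fnorm (M - R0) < d ->
    forall (S : 'M[R]_(k + l)) (eta : R), S^T = S -> 0 <= eta ->
    (forall q (W : 'M[R]_(l, q)),
      - (eta * fnorm W ^+ 2) <= fdot (Jmx *m S *m Jmx^T) (W *m W^T)) ->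
    forall E, E = gram M - gram R0 ->
    fdot S E <= c * (fnorm (Jmx *m S *m hat M) * fnorm E + eta * fnorm E ^+ 2)].
Proof.
move=> rk0; have [s rE] : exists s, r = (k + s)%N by exists (r - k)%N; rewrite subnKC.
subst r; rewrite -[R0]hsubmxK in rk0 *.
set A0 := lsubmx R0 in rk0 *; set B0 := rsubmx R0 in rk0 *.
have /row_fullP[K0 K0R] : row_full (row_mx A0 B0) by apply/eqP.
(* The last rows of a left inverse of the whole of [R0] form one of [B0]. *)
have KB0 : dsubmx K0 *m B0 = 1%:M.
  have := K0R; rewrite -{1}[K0]vsubmxK mul_col_row scalar_mx_block.
  by move/eq_block_mx => [].
have [d [c [d0 c0 HF]]] := fdot_gram_bound B0 (dsubmx K0) KB0.
pose b := 1 + (2 * fnorm A0 + d).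
have b0 : 0 <= b by rewrite !addr_ge0 ?mulr_ge0 ?fnorm_ge0// ltW.
have cb0 : 0 <= c * b by rewrite mulr_ge0.
have cbb0 : 0 <= c * b * b by rewrite mulr_ge0.
exists d, (2 + (1 + (c * b + c * b * b))); split=> //; first by rewrite !addr_ge0.
move=> M; rewrite -[M]hsubmxK; set A := lsubmx M; set B := rsubmx M => hM.
move=> S eta; rewrite -[S]submxK; set S11 := ulsubmx S; set S12 := ursubmx S.
set S21 := dlsubmx S; set S22 := drsubmx S.
rewrite tr_block_mx => /eq_block_mx[_ _ S12E SS] eta0.
rewrite Jmx_conj_block => hS E.
rewrite !gram_block opp_block_mx add_block_mx subrr -linearB /=.
set D := A - A0; set E22 := _ - _ => EE.
rewrite Jmx_mul_block; set Qa := S21 + _; set Qb := S22 *m B.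
pose F := B *m B^T - B0 *m B0^T.
move: hM; rewrite opp_row_mx add_row_mx -/D => hM.
have hD : fnorm D <= d by apply: le_trans (fnorm_lsub _ _) (ltW hM).
have hB : fnorm (B - B0) < d by apply: le_lt_trans (fnorm_rsub _ _) hM.
have hA : fnorm A <= fnorm A0 + d.
  by rewrite -[A](subrKC A0) -/D (le_trans (fnormD _ _))// lerD2l.
have DE : fnorm D <= fnorm E.
  rewrite EE block_mxEv; apply: le_trans (fnorm_dsub _ _).
  exact: fnorm_lsub.
have E22E : fnorm E22 <= fnorm E.
  rewrite EE block_mxEv; apply: le_trans (fnorm_dsub _ _).
  exact: fnorm_rsub.
have FE : F = E22 - (A *m D^T + D *m A0^T).
  have -> : A *m D^T + D *m A0^T = A *m A^T - A0 *m A0^T.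
    by rewrite /D linearB /= mulmxBl mulmxBr subrKA.
  by rewrite /E22 opprD addrACA (addrC (A *m A^T - _)) addrK.
have Fb : fnorm F <= b * fnorm E.
  rewrite FE; apply: le_trans (fnormB _ _) _.
  apply: le_trans (lerD E22E (fnormD _ _)) _.
  have h1 : fnorm (A *m D^T) <= (fnorm A0 + d) * fnorm E.
    by apply: le_trans (fnormM _ _) _; rewrite fnorm_tr ler_pM ?fnorm_ge0.
  have h2 : fnorm (D *m A0^T) <= fnorm A0 * fnorm E.
    by apply: le_trans (fnormM _ _) _; rewrite fnorm_tr mulrC ler_wpM2l ?fnorm_ge0.
  by move: h1 h2; rewrite /b; lra.
have SE : fdot (block_mx S11 S12 S21 S22) E =
    2 * fdot Qa D - fdot S22 (D *m D^T) + fdot S22 F.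
  rewrite EE fdot_block_mx -(fdot_tr S12) trmxK S12E.
  have -> : E22 = F + A *m D^T + D *m A^T - D *m D^T.
    have -> : D *m A^T = D *m A0^T + D *m D^T.
      by rewrite -mulmxDr -linearD /= /D subrKC.
    by rewrite FE !addrA addrK -addrA subrK.
  rewrite fdot_symmetric_expand// /Qa fdotDl fdot0r add0r.
  move: (fdot S21 D) (fdot (S22 *m A) D) (fdot S22 F) (fdot S22 _) => *.
  by lra.
have hQa : fnorm Qa <= fnorm (row_mx Qa Qb) by exact: fnorm_lsub.
have hQb : fnorm Qb <= fnorm (row_mx Qa Qb) by exact: fnorm_rsub.
set q := fnorm (row_mx _ _) in hQa hQb *; rewrite SE.
have q0 : 0 <= q by exact: fnorm_ge0.
have e0 := fnorm_ge0 E; set e := fnorm E in DE E22E Fb e0 *.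
have T1 : fdot Qa D <= q * e.
  by apply: le_trans (fdot_le_fnorm _ _) _; rewrite ler_pM ?fnorm_ge0.
have T2 : - fdot S22 (D *m D^T) <= eta * e ^+ 2.
  apply: le_trans (_ : eta * fnorm D ^+ 2 <= _); first by have := hS _ D; lra.
  by rewrite ler_wpM2l// lerXn2r ?nnegrE ?fnorm_ge0.
have T3 : fdot S22 F <= c * (q * (b * e) + eta * (b * e) ^+ 2).
  apply: le_trans (HF B hB S22 eta SS eta0 (hS s) F erefl) _.
  rewrite ler_wpM2l// lerD//; first by rewrite ler_pM ?fnorm_ge0.
  by rewrite ler_wpM2l// lerXn2r ?nnegrE ?fnorm_ge0// mulr_ge0.
have T4 : 0 <= (1 + c * b * b) * (q * e) by rewrite !mulr_ge0 ?addr_ge0.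
have T5 : 0 <= (2 + c * b) * (eta * e ^+ 2) by rewrite !mulr_ge0 ?addr_ge0 ?sqr_ge0.
have T6 : 0 <= q * e by rewrite mulr_ge0.
have T7 : 0 <= eta * e ^+ 2 by rewrite mulr_ge0 ?sqr_ge0.
by move: T1 T2 T3 T4 T5 T6 T7; lra.
Qed.

End SlackBound.

(** * First-order calculus for functions of a symmetric matrix *)

Section Calculus.
Context {R : realType}.

Lemma linear_fdot {a b : nat} (g : {linear 'M[R]_(a, b) -> R^o}) v :
  g v = fdot (\matrix_(i, j) g (delta_mx i j)) v.
Proof.
rewrite {1}[v]matrix_sum_delta linear_sum fdotE; apply: eq_bigr => i _.
rewrite linear_sum; apply: eq_bigr => j _.
by rewrite linearZ mxE mulrC.
Qed.

Lemma diff_pdot {a b p : nat} (F : 'M[R]_(a, b) * 'cV[R]_p -> R) z v :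
  'd (F : _ -> R^o) z v = pdot (nabla F z) v.
Proof.
have lin1 : linear (fun M : 'M[R]_(a, b) => 'd (F : _ -> R^o) z (M, 0)).
  move=> t M N; rewrite -linearP; congr ('d _ z _).
  by congr (_, _); rewrite /= scaler0 addr0.
have lin2 : linear (fun y : 'cV[R]_p => 'd (F : _ -> R^o) z (0, y)).
  move=> t M N; rewrite -linearP; congr ('d _ z _).
  by congr (_, _); rewrite /= scaler0 addr0.
pose g1 : {linear 'M[R]_(a, b) -> R^o} :=
  HB.pack (fun M : 'M[R]_(a, b) => 'd (F : _ -> R^o) z (M, 0))
    (GRing.isLinear.Build _ _ _ _ _ lin1).
pose g2 : {linear 'cV[R]_p -> R^o} :=
  HB.pack (fun y : 'cV[R]_p => 'd (F : _ -> R^o) z (0, y))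
    (GRing.isLinear.Build _ _ _ _ _ lin2).
have -> : v = (v.1, 0) + (0, v.2).
  by case: v => v1 v2; congr (_, _); rewrite /= ?addr0 ?add0r.
rewrite linearD /= -[X in X + _]/(g1 v.1) -[X in _ + X]/(g2 v.2) !linear_fdot /pdot.
rewrite /= addr0 add0r; congr (fdot _ _ + fdot _ _).
by apply/matrixP => i j; rewrite !mxE ord1.
Qed.

Lemma differentiable_mx {V : normedModType R} {a b : nat} (f : V -> 'M[R]_(a, b)) x :
  (forall i j, differentiable (fun z => f z i j : R^o) x) -> differentiable f x.
Proof.
move=> df.
have -> : f = \sum_i \sum_j (fun z => f z i j *: delta_mx i j).
  apply/funext => z; rewrite fct_sumE {1}[f z]matrix_sum_delta.
  by apply: eq_bigr => i _; rewrite fct_sumE.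
apply: differentiable_sum => i; apply: differentiable_sum => j.
exact: differentiableZl.
Qed.

Lemma sympart_id {a : nat} (M : 'M[R]_a) : symmetric_mx M -> sympart M = M.
Proof.
move=> MM; rewrite /sympart MM -mulr2n -[M *+ 2]scaler_nat scalerA mulVf ?scale1r//.
Qed.

Lemma symext_id {a p : nat} (F : 'M[R]_a * 'cV[R]_p -> R) z :
  symmetric_mx z.1 -> symext F z = F z.
Proof. by move=> zz; rewrite /symext sympart_id//; case: z zz. Qed.

(** At a symmetric point the symmetrised function takes the same values along a
direction and along its transpose. *)
Lemma nabla_symext_sym {a p : nat} (F : 'M[R]_a * 'cV[R]_p -> R) z :
  symmetric_mx z.1 -> differentiable (symext F : _ -> R^o) z ->
  symmetric_mx (nabla (symext F) z).1.
Proof.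
move=> zz dF; apply/matrixP => i j; rewrite mxE [LHS]mxE [RHS]mxE.
rewrite -(deriveE (delta_mx j i, 0) dF) -(deriveE (delta_mx i j, 0) dF).
suff E : (fun h : R => symext F (h *: (delta_mx j i, 0) + z)) =
    (fun h => symext F (h *: (delta_mx i j, 0) + z)).
  exact: (congr1 (fun f : R -> R^o =>
    lim ((fun h => h^-1 *: (f h - symext F z)) @ (0 : R)^')) E).
apply/funext => h.
rewrite /symext /= /sympart; congr (F (_ *: _, _)).
rewrite !linearD !linearZ /= !trmx_delta zz.
by rewrite addrACA [RHS]addrACA; congr (_ + _); rewrite addrC.
Qed.

Lemma convex_first_order {a p : nat} (F : 'M[R]_a * 'cV[R]_p -> R) x y :
  convex_on_sym F -> differentiable (symext F : _ -> R^o) x ->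
  symmetric_mx x.1 -> symmetric_mx y.1 ->
  F x + pdot (nabla (symext F) x) (y - x) <= F y.
Proof.
move=> cF dF sx sy; rewrite -diff_pdot -deriveE// addrC -lerBrDr.
have dv := @diff_derivable _ _ _ (symext F : _ -> R^o) x (y - x) dF.
rewrite /derive (cvg_at_rightE _ _ dv); apply: limr_le.
  case/cvg_ex: dv => l hl; apply/cvg_ex; exists l; exact: cvg_dnbhs_at_right hl.
near=> h.
have h0 : 0 < h by near: h; exact: nbhs_right_gt.
have h1 : h <= 1 by near: h; exact: nbhs_right_ltW.
have hxy : h *: (y - x) + x = h *: y + (1 - h) *: x.
  by rewrite scalerBr scalerBl scale1r addrAC -addrA.
have sh : symmetric_mx (h *: y + (1 - h) *: x).1.
  by rewrite /symmetric_mx linearD !linearZ /= sx sy.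
rewrite /= hxy !symext_id//.
have := cF (Itv01 (ltW h0) h1) y x; rewrite !inE => /(_ sy sx).
rewrite /conv /= => H.
rewrite [_ *: _]mulrC ler_pdivrMr//.
have {}H : F (h *: y + (1 - h) *: x) <= h * F y + (1 - h) * F x by exact: H.
by move: H; lra.
Unshelve. all: by end_near. Qed.

End Calculus.

(** * Gradients of the factorised problem *)

Section Lift.
Context {R : realType} {k l p r : nat}.

Lemma gram_sym (M : 'M[R]_(l, r)) : symmetric_mx (gram (k := k) M).
Proof. by rewrite /symmetric_mx /gram trmx_mul trmxK. Qed.

Lemma LmapE (M H : 'M[R]_(l, r)) :
  Lmap (k := k) M H = hat M *m (col_mx 0 H)^T + col_mx 0 H *m (hat M)^T.
Proof.
rewrite /Lmap /hat !tr_col_mx !mul_col_row add_block_mx.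
by rewrite !trmx0 !mulmx0 !mul0mx !addr0 !add0r.
Qed.

Lemma fdot_Lmap (C : 'M[R]_(k + l)) (M H : 'M[R]_(l, r)) : symmetric_mx C ->
  fdot C (Lmap M H) = fdot (2 *: (Jmx *m C *m hat M)) H.
Proof.
move=> CC; have HJ : col_mx 0 H = (Jmx (R := R) (k := k))^T *m H.
  by rewrite /Jmx tr_row_mx mul_col_mx trmx0 trmx1 mul0mx mul1mx.
rewrite LmapE fdotDr (fdot_mulr (col_mx 0 H)) trmxK (fdot_mull (hat M)).
rewrite -(fdot_tr ((hat M)^T *m C)) trmx_mul !trmxK CC HJ fdot_mull trmxK.
by rewrite mulmxA fdotZl; lra.
Qed.

Lemma fdot_hadamard (c y h : 'cV[R]_p) :
  fdot c (hadamard y h) = fdot (hadamard c y) h.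
Proof.
rewrite !fdotE; apply: eq_bigr => i _; apply: eq_bigr => j _.
by rewrite !mxE mulrA.
Qed.

Lemma gram_expand (M H : 'M[R]_(l, r)) (t : R) :
  gram (k := k) (t *: H + M) =
  gram M + t *: Lmap M H + t ^+ 2 *: (col_mx 0 H *m (col_mx 0 H)^T).
Proof.
have hE : hat (k := k) (t *: H + M) = hat M + t *: col_mx 0 H.
  by rewrite /hat scale_col_mx scaler0 add_col_mx addr0 addrC.
rewrite /gram hE LmapE linearD linearZ /= mulmxDl !mulmxDr.
rewrite -!scalemxAl -!scalemxAr scalerA expr2 scalerDr !addrA.
by congr (_ + _); rewrite addrAC -!addrA; congr (_ + _); rewrite addrC.
Qed.

(** The entries of the lifted point are polynomials of degree two in those of the
pair. *)
Lemma differentiable_lift (z : 'M[R]_(l, r) * 'cV[R]_p) :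
  differentiable (lift_pt (k := k)) z.
Proof.
have dfst i j : differentiable (fun w : 'M[R]_(l, r) * 'cV[R]_p => w.1 i j : R^o) z.
  apply: (differentiable_comp (f := fst) (g := fun M : 'M[R]_(l, r) => M i j : R^o)).
    by apply: linear_differentiable => u; exact: cvg_fst.
  exact: differentiable_coord.
have dsnd i j : differentiable (fun w : 'M[R]_(l, r) * 'cV[R]_p => w.2 i j : R^o) z.
  apply: (differentiable_comp (f := snd) (g := fun M : 'cV[R]_p => M i j : R^o)).
    by apply: linear_differentiable => u; exact: cvg_snd.
  exact: differentiable_coord.
have dhat i j : differentiable
    (fun w : 'M[R]_(l, r) * 'cV[R]_p => hat (k := k) w.1 i j : R^o) z.
  rewrite /hat; case: (fintype.split_ordP i) => i' ->.
    by under eq_fun do rewrite col_mxEu; exact: differentiable_cst.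
  by under eq_fun do rewrite col_mxEd; exact: dfst.
apply: differentiable_pair; apply: differentiable_mx => i j.
  rewrite (_ : (fun _ => _) =
    \sum_(h < r) ((fun w : 'M[R]_(l, r) * 'cV[R]_p => hat (k := k) w.1 i h : R^o) *
                  (fun w => hat w.1 j h))); last first.
    apply/funext => w; rewrite fct_sumE mxE; apply: eq_bigr => h _.
    by rewrite [(hat w.1)^T h j]mxE.
  by apply: differentiable_sum => h; apply: differentiableM.
rewrite (_ : (fun _ => _) = (fun w : 'M[R]_(l, r) * 'cV[R]_p => w.2 i j : R^o) *
                  (fun w => w.2 i j)); last first.
  by apply/funext => w; rewrite mxE.
exact: differentiableM.
Qed.

(** The lifted point is exactly quadratic along a line, see [gram_expand], so the
difference quotient is the claimed derivative plus a multiple of the step. *)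
Lemma diff_lift (z v : 'M[R]_(l, r) * 'cV[R]_p) :
  'd (lift_pt (k := k)) z v = (Lmap z.1 v.1, 2 *: hadamard z.2 v.2).
Proof.
rewrite -(deriveE v (differentiable_lift z)) /derive; apply: cvg_lim => //.
pose Q : 'M[R]_(k + l) * 'cV[R]_p :=
  (col_mx 0 v.1 *m (col_mx 0 v.1)^T, hadamard v.2 v.2).
pose L : 'M[R]_(k + l) * 'cV[R]_p := (Lmap z.1 v.1, 2 *: hadamard z.2 v.2).
have LQ : (fun t : R => L + t *: Q) @ (0 : R)^' --> L.
  suff : (fun t : R => L + t *: Q) @ (0 : R)^' --> L + (0 : R) *: Q.
    by rewrite scale0r addr0.
  apply: cvgD; first exact: cvg_cst.
  by apply: cvgZl; apply: cvg_within_filter; exact: cvg_id.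
apply: cvg_trans LQ; apply: near_eq_cvg; near=> t.
have t0 : t != 0 by near: t; exact: nbhs_dnbhs_neq.
have liftE : lift_pt (k := k) (t *: v + z) = lift_pt z + t *: L + t ^+ 2 *: Q.
  congr (_, _); first by rewrite /= gram_expand.
  by apply/matrixP => i j; rewrite !mxE /=; ring.
rewrite -[(lift_pt \o shift z) _]/(lift_pt (t *: v + z)) liftE.
rewrite -[lift_pt z + _ + _]addrA [_ - lift_pt z]addrC addKr scalerDr.
by rewrite !scalerA mulVf// scale1r expr2 mulKf.
Unshelve. all: by end_near. Qed.

End Lift.

Section SdpGradient.
Context {R : realType} {k l m p : nat} (P : sdp R k l m p).
Context (phi_convex : convex_on_sym (phi P)).
Context (phi_C1 : C1_on_sym (phi P)).
Context {r : nat}.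
Implicit Types z : 'M[R]_(l, r) * 'cV[R]_p.

Lemma fr_symext : fr P (r := r) = symext (phi P) \o lift_pt.
Proof. by apply/funext => z; rewrite /= symext_id//; exact: gram_sym. Qed.

Lemma Cmx_sym z : symmetric_mx (Cmx P z).
Proof. by apply: nabla_symext_sym; [exact: gram_sym | apply: (proj1 phi_C1)]. Qed.

Lemma nabla_fr z :
  nabla (fr P) z =
  (2 *: (Jmx *m Cmx P z *m hat z.1), 2 *: hadamard (cvec P z) z.2).
Proof.
have dE v : 'd (fr P : _ -> R^o) z v =
    fdot (2 *: (Jmx *m Cmx P z *m hat z.1)) v.1 +
    fdot (2 *: hadamard (cvec P z) z.2) v.2.
  rewrite fr_symext.
  rewrite (diff_comp (f := lift_pt) (g := symext (phi P) : _ -> R^o)); last 2 first.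
  - exact: differentiable_lift.
  - exact: (proj1 phi_C1).
  rewrite /= diff_lift diff_pdot /pdot /= fdot_Lmap; last exact: Cmx_sym.
  by rewrite -/(Cmx P z) -/(cvec P z) fdotZr !fdotZl fdot_hadamard.
congr (_, _); apply/matrixP => i j.
  by rewrite mxE dE /= fdot0r addr0 fdot_delta.
by rewrite mxE dE /= fdot0r add0r fdot_delta ord1.
Qed.

Lemma differentiable_fr z : differentiable (fr P : _ -> R^o) z.
Proof.
rewrite fr_symext; apply: differentiable_comp; first exact: differentiable_lift.
exact: (proj1 phi_C1).
Qed.

Lemma rgradE z :
  rgrad P z = (2 *: (Jmx *m (Cmx P z - Aadj P (lagmult P z)) *m hat z.1),
               2 *: hadamard (slackv P z) z.2).
Proof.
rewrite /rgrad nabla_fr /DGadj; congr (_, _); rewrite /= -scalerBr.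
  by rewrite mulmxBr mulmxBl.
by congr (_ *: _); apply/matrixP => i j; rewrite !mxE mulrBl.
Qed.

Lemma slackME z :
  slackM P z = Jmx *m (Cmx P z - Aadj P (lagmult P z)) *m Jmx^T.
Proof. by rewrite mulmxBr mulmxBl. Qed.

Lemma Kop_adjoint (lam : 'cV[R]_m) X x :
  fdot (Aadj P lam) X + fdot ((Bmx P)^T *m lam) x = fdot lam (Kop P X x).
Proof.
rewrite /Kop fdotDr fdot_mull; congr (_ + _).
rewrite /Aadj [RHS]fdotE; under [RHS]eq_bigr do rewrite big_ord1 mxE.
rewrite fdotC; elim/big_ind2: _ => [|x1 x2 y1 y2 <- <-|i _]; first exact: fdot0r.
  by rewrite fdotDr.
by rewrite fdotZr fdotC.
Qed.

(** First-order convexity at [z]; subtracting the multiplier terms costs nothing,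
because by [Kop_adjoint] they are the pairing of [lam] with the difference of
two equal values of [Kop]. *)
Lemma fr_gap_le z zs (lam : 'cV[R]_m) : Omega P r z -> Omega P r zs ->
  fr P z - fr P zs <= fdot (Cmx P z - Aadj P lam) (gram z.1 - gram zs.1) +
     fdot (cvec P z - (Bmx P)^T *m lam) (hadamard z.2 z.2 - hadamard zs.2 zs.2).
Proof.
move=> Oz Os.
have := convex_first_order _ (lift_pt z) (lift_pt zs) phi_convex (proj1 phi_C1 _)
  (gram_sym _) (gram_sym _).
have : fdot (Aadj P lam) (gram z.1 - gram zs.1) +
    fdot ((Bmx P)^T *m lam) (hadamard z.2 z.2 - hadamard zs.2 zs.2) = 0.
  rewrite !fdotBr addrACA -opprD !Kop_adjoint -fdotBr.
  have /eqP := Oz; rewrite subr_eq0 => /eqP ->.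
  by have /eqP := Os; rewrite subr_eq0 => /eqP ->; rewrite subrr fdot0r.
rewrite /pdot /= -/(Cmx P z) -/(cvec P z) -/(fr P z) -/(fr P zs) !fdotBl !fdotBr.
by lra.
Qed.

End SdpGradient.

(** * Continuity of the multiplier *)

Section LowerBound.
Context {R : realType}.

Lemma fnorm_hadamard {a b : nat} (M N : 'M[R]_(a, b)) :
  fnorm (hadamard M N) <= fnorm M * fnorm N.
Proof.
rewrite -ler_sqr ?nnegrE ?mulr_ge0 ?fnorm_ge0// exprMn fnorm_sqr (fnorm_sqr N).
rewrite !fdotE mulr_sumr.
apply: ler_sum => i _; rewrite mulr_sumr; apply: ler_sum => j _.
rewrite mxE mulrACA ler_wpM2r -?expr2 ?sqr_ge0//.
by rewrite -[leLHS]real_normK ?num_real// lerXn2r ?nnegrE ?fnorm_ge0 ?entry_le_fnorm.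
Qed.

(** In coordinates an injective linear map is right multiplication by a row-free
matrix, and a right inverse of that matrix provides the constant. *)
Lemma injective_lower_bound {m a b p : nat}
    (f : {linear 'cV[R]_m -> ('M[R]_(a, b) * 'cV[R]_p)%type}) : injective f ->
  exists2 c, 0 <= c & forall v, fnorm v <= c * (fnorm (f v).1 + fnorm (f v).2).
Proof.
move=> finj.
pose g (u : 'rV[R]_m) : 'rV[R]_(a * b + p) := row_mx (mxvec (f u^T).1) (f u^T).2^T.
have glin : linear g.
  by move=> t u v; rewrite /g scale_row_mx add_row_mx !linearP.
pose gL : {linear 'rV[R]_m -> 'rV[R]_(a * b + p)} :=
  HB.pack g (GRing.isLinear.Build _ _ _ _ _ glin).
have gE u : u *m lin1_mx gL = g u by rewrite mul_rV_lin1.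
have /row_freeP[Q DQ] : row_free (lin1_mx gL).
  apply: inj_row_free => u; rewrite gE => gu0.
  apply: trmx_inj; apply: finj; rewrite trmx0 linear0.
  move: gu0; rewrite /g -[0]row_mx0 => /eq_row_mx[h1 h2].
  rewrite [f _]surjective_pairing; congr (_, _).
    by rewrite -[LHS]mxvecK h1 linear0.
  by rewrite -[LHS]trmxK h2 trmx0.
exists (fnorm Q) => [|v]; first exact: fnorm_ge0.
rewrite -(fnorm_tr v) -[v^T]mulmx1 -DQ mulmxA gE mulrC.
apply: le_trans (fnormM _ _) _; rewrite ler_wpM2r ?fnorm_ge0//.
rewrite -ler_sqr ?nnegrE ?addr_ge0 ?fnorm_ge0// /g trmxK fnorm_row_mx fnorm_tr.
have -> : fnorm (mxvec (f v).1) = fnorm (f v).1.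
  rewrite /fnorm !fdotE big_ord1 pair_bigA (reindex _ (curry_mxvec_bij a b)) /=.
  by congr (Num.sqrt _); apply: eq_bigr => -[i j] _; rewrite mxvecE.
rewrite sqrrD lerD2r lerDl mulrn_wge0// mulr_ge0 ?fnorm_ge0//.
Qed.

End LowerBound.

Section Multiplier.
Context {R : realType} {k l m p : nat} (P : sdp R k l m p).
Context (phi_C1 : C1_on_sym (phi P)).
Context {r : nat}.
Implicit Types z zs : 'M[R]_(l, r) * 'cV[R]_p.

Lemma Aadj_linear : linear (Aadj P).
Proof.
move=> t u v; rewrite /Aadj scaler_sumr -big_split /=; apply: eq_bigr => i _.
by rewrite !mxE scalerDl scalerA.
Qed.

HB.instance Definition _ :=
  GRing.isLinear.Build R 'cV[R]_m 'M[R]_(k + l) _ (Aadj P) Aadj_linear.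

Lemma DGadj_linear z : linear (DGadj P z).
Proof.
move=> t u v; rewrite /DGadj; congr (_, _) => /=.
  rewrite linearP /= mulmxDr mulmxDl -scalemxAr -scalemxAl scalerDr.
  by rewrite !scalerA mulrC.
by apply/matrixP => i j; rewrite linearP !mxE; ring.
Qed.

Lemma fnorm_Aadj lam :
  fnorm (Aadj P lam) <= (\sum_i fnorm (Amx P i)) * fnorm lam.
Proof.
apply: le_trans (fnorm_sum _) _; rewrite mulr_suml; apply: ler_sum => i _.
by rewrite fnormZ mulrC ler_wpM2l ?fnorm_ge0 ?entry_le_fnorm.
Qed.

Lemma near_gradient zs e : 0 < e ->
  \forall z \near zs, [/\ fnorm (z.1 - zs.1) < e, fnorm (z.2 - zs.2) < e,
    fnorm (Cmx P z - Cmx P zs) < e & fnorm (cvec P z - cvec P zs) < e].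
Proof.
move=> e0.
have gradc : {for zs, continuous (fun z => nabla (symext (phi P)) (lift_pt z))}.
  apply: continuous_comp; last exact: (proj2 phi_C1).
  exact/differentiable_continuous/differentiable_lift.
have c1 : Cmx P z @[z --> nbhs zs] --> Cmx P zs.
  exact: (cvg_comp _ fst gradc cvg_fst).
have c2 : cvec P z @[z --> nbhs zs] --> cvec P zs.
  exact: (cvg_comp _ snd gradc cvg_snd).
have c3 : (z.1 : 'M[R]_(l, r)) @[z --> nbhs zs] --> zs.1 by exact: cvg_fst.
have c4 : (z.2 : 'cV[R]_p) @[z --> nbhs zs] --> zs.2 by exact: cvg_snd.
near=> z; split; near: z.
- exact: fnorm_lt_cvg c3 _ e0.
- exact: fnorm_lt_cvg c4 _ e0.
- exact: fnorm_lt_cvg c1 _ e0.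
- exact: fnorm_lt_cvg c2 _ e0.
Unshelve. all: by end_near. Qed.

Lemma fnorm_hatB z zs : fnorm (hat (k := k) z.1 - hat zs.1) = fnorm (z.1 - zs.1).
Proof.
rewrite /hat opp_col_mx add_col_mx subrr; apply/eqP.
rewrite -(@eqrXn2 _ 2) ?fnorm_ge0// fnorm_col_mx.
by rewrite fnorm0 expr0n add0r.
Qed.

(** The multiplier difference [A - A0] is expressed through the gradient at the
nearby point, [J *m (C - A) *m h], and quantities that are small there. *)
Lemma mulmx_slack_perturbation {a b c : nat} (J : 'M[R]_(a, b)) (C C0 A A0 : 'M[R]_b)
    (h h0 : 'M[R]_(b, c)) : J *m (C0 - A0) *m h0 = 0 ->
  J *m (A - A0) *m h0 =
  J *m (C - C0) *m h0 - J *m (C - A) *m h + J *m (C - A) *m (h - h0).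
Proof.
rewrite (mulmxBr _ h) !mulmxBr !mulmxBl.
move: (J *m C *m h) (J *m A *m h) (J *m C *m h0) (J *m A *m h0) (J *m C0 *m h0)
  (J *m A0 *m h0) => M1 M2 M3 M4 M5 M6 H.
apply/matrixP => i j; have := congr1 (fun M : 'M[R]_(a, c) => M i j) H.
by rewrite !mxE; lra.
Qed.

Lemma hadamard_slack_perturbation (c c0 a a0 y y0 : 'cV[R]_p) :
  hadamard (c0 - a0) y0 = 0 ->
  hadamard (a - a0) y0 =
  hadamard (c - c0) y0 - hadamard (c - a) y + hadamard (c - a) (y - y0).
Proof.
move=> H; apply/matrixP => i j; have := congr1 (fun M : 'cV[R]_p => M i j) H.
by rewrite !mxE; lra.
Qed.

(** With [mu] the multiplier difference, [DGadj zs mu] is the sum of the gradient at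
[z] and of terms of size [th * (K1 + K2 * fnorm mu)]; the lower bound for the
injective map [DGadj zs] then gives [fnorm mu <= c * th * (K1 + K2 * fnorm mu)],
and for small [th] the last term is absorbed. *)
Lemma lagmult_near zs e : LICQ P zs -> rgrad P zs = 0 -> 0 < e ->
  exists2 eta, 0 < eta & \forall z \near zs, pnorm (rgrad P z) < eta ->
    fnorm (lagmult P z - lagmult P zs) <= e.
Proof.
move=> licq gs0 e0.
pose DL : {linear 'cV[R]_m -> ('M[R]_(l, r) * 'cV[R]_p)%type} :=
  HB.pack (DGadj P zs) (GRing.isLinear.Build _ _ _ _ _ (DGadj_linear zs)).
have [c c0 hc] := injective_lower_bound DL licq.
pose ca := \sum_i fnorm (Amx P i).
have ca0 : 0 <= ca by rewrite sumr_ge0// => i _; rewrite fnorm_ge0.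
pose nJ := fnorm (Jmx : 'M[R]_(l, k + l)).
pose ls := lagmult P zs.
(* [K1] and [K2] collect the constants of the bounds [B1] and [B2] below. *)
pose K1 := 2 * nJ * fnorm (hat (k := k) zs.1) + 1 +
  2 * nJ * (fnorm (Cmx P zs) + 1 + ca * fnorm ls) +
  (2 * fnorm zs.2 + 1 + 2 * (fnorm (cvec P zs) + 1 + fnorm (Bmx P) * fnorm ls)).
pose K2 := 2 * nJ * ca + 2 * fnorm (Bmx P).
have K10 : 0 <= K1 by rewrite /K1 !addr_ge0 ?mulr_ge0 ?addr_ge0 ?mulr_ge0 ?fnorm_ge0.
have K20 : 0 <= K2 by rewrite /K2 addr_ge0 ?mulr_ge0 ?fnorm_ge0.
(* [th <= 1] bounds the gradients near [zs], the second bound absorbs the term in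
   [K2] and the third makes the result at most [e]. *)
pose th := Num.min 1 (Num.min (2 * (c * K2 + 1))^-1 (e / (2 * (c * K1) + 1))).
have th0 : 0 < th.
  by rewrite !lt_min ltr01 invr_gt0 divr_gt0 ?mulr_gt0 ?ltr_wpDl ?mulr_ge0.
have th1 : th <= 1 by rewrite ge_min lexx.
have thK2 : c * K2 * th <= 2^-1.
  apply: (@le_trans _ _ ((c * K2 + 1) * (2 * (c * K2 + 1))^-1)).
    by rewrite ler_pM ?mulr_ge0 ?lerDl ?(ltW th0)// !ge_min lexx /= orbT.
  by rewrite invfM mulrCA mulfV ?mulr1// gt_eqF// ltr_wpDl ?mulr_ge0.
have thK1 : 2 * (c * K1) * th <= e.
  apply: (@le_trans _ _ ((2 * (c * K1) + 1) * (e / (2 * (c * K1) + 1)))).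
    by rewrite ler_pM ?mulr_ge0 ?lerDl ?(ltW th0)// !ge_min lexx /= !orbT.
  by rewrite mulrC divfK// gt_eqF// ltr_wpDl ?mulr_ge0.
exists th => //; near=> z => gth.
have [d1 d2 d3 d4] : [/\ fnorm (z.1 - zs.1) < th, fnorm (z.2 - zs.2) < th,
    fnorm (Cmx P z - Cmx P zs) < th & fnorm (cvec P z - cvec P zs) < th].
  by near: z; exact: near_gradient.
set mu := lagmult P z - lagmult P zs.
pose S := Cmx P z - Aadj P (lagmult P z).
have g1 : fnorm (rgrad P z).1 < th by apply: le_lt_trans gth; exact: fnorm_fst_le_pnorm.
have g2 : fnorm (rgrad P z).2 < th by apply: le_lt_trans gth; exact: fnorm_snd_le_pnorm.
have hl : fnorm (lagmult P z) <= fnorm mu + fnorm ls.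
  by rewrite -[lagmult P z](subrK ls); exact: fnormD.
have E1 : (DL mu).1 = 2 *: (Jmx *m (Cmx P z - Cmx P zs) *m hat zs.1)
    - (rgrad P z).1 + 2 *: (Jmx *m S *m (hat z.1 - hat zs.1)).
  have := congr1 fst gs0; rewrite !rgradE//= => /eqP.
  rewrite scaler_eq0 pnatr_eq0 /= => /eqP gs1.
  rewrite -scalerBr -scalerDr (linearB (Aadj P)) /=; congr (_ *: _).
  exact: mulmx_slack_perturbation.
have E2 : (DL mu).2 = 2 *: hadamard (cvec P z - cvec P zs) zs.2
    - (rgrad P z).2 + 2 *: hadamard (slackv P z) (z.2 - zs.2).
  have := congr1 snd gs0; rewrite !rgradE//= => /eqP.
  rewrite scaler_eq0 pnatr_eq0 /= => /eqP gs2.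
  rewrite -scalerBr -scalerDr mulmxBr; congr (_ *: _).
  exact: hadamard_slack_perturbation.
have B1 : fnorm (DL mu).1 <= 2 * (nJ * th * fnorm (hat (k := k) zs.1)) + th +
    2 * (nJ * (fnorm (Cmx P zs) + 1 + ca * (fnorm mu + fnorm ls)) * th).
  rewrite E1; apply: le_trans (fnormD _ _) _; apply: lerD; last first.
    rewrite fnormZ normr_nat ler_wpM2l//; apply: le_trans (fnormM _ _) _.
    rewrite fnorm_hatB; apply: ler_pM; rewrite ?fnorm_ge0 ?(ltW d1)//.
    apply: le_trans (fnormM _ _) _; rewrite ler_wpM2l ?fnorm_ge0//.
    apply: le_trans (fnormB _ _) _; apply: lerD.
      rewrite -[Cmx P z](subrKC (Cmx P zs)); apply: le_trans (fnormD _ _) _.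
      by rewrite lerD2l (le_trans (ltW d3)).
    by apply: le_trans (fnorm_Aadj _) _; rewrite ler_wpM2l.
  apply: le_trans (fnormB _ _) _; apply: lerD; last exact: ltW.
  rewrite fnormZ normr_nat ler_wpM2l//; apply: le_trans (fnormM _ _) _.
  rewrite ler_wpM2r ?fnorm_ge0//; apply: le_trans (fnormM _ _) _.
  by rewrite ler_wpM2l ?fnorm_ge0 ?ltW.
have B2 : fnorm (DL mu).2 <= 2 * (th * fnorm zs.2) + th +
    2 * ((fnorm (cvec P zs) + 1 + fnorm (Bmx P) * (fnorm mu + fnorm ls)) * th).
  rewrite E2; apply: le_trans (fnormD _ _) _; apply: lerD; last first.
    rewrite fnormZ normr_nat ler_wpM2l//; apply: le_trans (fnorm_hadamard _ _) _.
    apply: ler_pM; rewrite ?fnorm_ge0 ?(ltW d2)//.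
    apply: le_trans (fnormB _ _) _; apply: lerD.
      rewrite -[cvec P z](subrKC (cvec P zs)); apply: le_trans (fnormD _ _) _.
      by rewrite lerD2l (le_trans (ltW d4)).
    apply: le_trans (fnormM _ _) _; rewrite fnorm_tr.
    by rewrite ler_wpM2l ?fnorm_ge0.
  apply: le_trans (fnormB _ _) _; apply: lerD; last exact: ltW.
  rewrite fnormZ normr_nat ler_wpM2l//; apply: le_trans (fnorm_hadamard _ _) _.
  by rewrite ler_wpM2r ?fnorm_ge0 ?ltW.
have muB : fnorm mu <= c * (th * (K1 + K2 * fnorm mu)).
  apply: le_trans (hc mu) _; rewrite ler_wpM2l//.
  apply: le_trans (lerD B1 B2) _; rewrite /K1 /K2.
  by rewrite le_eqVlt; apply/orP; left; apply/eqP; ring.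
have muH : fnorm mu <= c * K1 * th + fnorm mu * 2^-1.
  apply: le_trans muB _.
  have -> : c * (th * (K1 + K2 * fnorm mu)) = c * K1 * th + fnorm mu * (c * K2 * th).
    by ring.
  by rewrite lerD2l ler_wpM2l ?fnorm_ge0.
apply: le_trans (half_bound _ _ muH) _.
by rewrite mulrA.
Unshelve. all: by end_near. Qed.

Lemma slackM_near zs e : LICQ P zs -> rgrad P zs = 0 -> 0 < e ->
  exists2 eta, 0 < eta & \forall z \near zs, pnorm (rgrad P z) < eta ->
    fnorm (slackM P z - slackM P zs) <= e.
Proof.
move=> licq gs0 e0.
pose ca := \sum_i fnorm (Amx P i).
have ca0 : 0 <= ca by rewrite sumr_ge0// => i _; rewrite fnorm_ge0.
pose nJ := fnorm (Jmx : 'M[R]_(l, k + l)).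
pose th := e / (nJ * nJ * (1 + ca) + 1).
have den0 : 0 < nJ * nJ * (1 + ca) + 1.
  by rewrite ltr_wpDl// mulr_ge0 ?addr_ge0// mulr_ge0 ?fnorm_ge0.
have th0 : 0 < th by rewrite divr_gt0.
have [eta eta0 hl] := lagmult_near zs th licq gs0 th0.
exists eta => //; near=> z => geta.
have mu_th : fnorm (lagmult P z - lagmult P zs) <= th by move: geta; near: z.
have [_ _ d3 _] : [/\ fnorm (z.1 - zs.1) < th, fnorm (z.2 - zs.2) < th,
    fnorm (Cmx P z - Cmx P zs) < th & fnorm (cvec P z - cvec P zs) < th].
  by near: z; exact: near_gradient.
have -> : slackM P z - slackM P zs =
    Jmx *m ((Cmx P z - Cmx P zs) - Aadj P (lagmult P z - lagmult P zs)) *m Jmx^T.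
  have swap (V : zmodType) (a b c d : V) : (a - b) - (c - d) = (a - c) - (b - d).
    by rewrite !opprD !opprK addrACA.
  rewrite !slackME -mulmxBl -mulmxBr (linearB (Aadj P)) /=.
  by rewrite [X in _ = _ *m X *m _]swap.
apply: (@le_trans _ _ (nJ * (th + ca * th) * nJ)); last first.
  have -> : nJ * (th + ca * th) * nJ = (nJ * nJ * (1 + ca)) * th by ring.
  apply: (@le_trans _ _ ((nJ * nJ * (1 + ca) + 1) * th)).
    by rewrite ler_wpM2r ?(ltW th0)// lerDl.
  by rewrite mulrC divfK// gt_eqF.
apply: le_trans (fnormM _ _) _; rewrite fnorm_tr ler_wpM2r ?fnorm_ge0//.
apply: le_trans (fnormM _ _) _; rewrite ler_wpM2l ?fnorm_ge0//.
apply: le_trans (fnormB _ _) _; apply: lerD; first exact: ltW.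
by apply: le_trans (fnorm_Aadj _) _; rewrite ler_wpM2l.
Unshelve. all: by end_near. Qed.

End Multiplier.

(** * Gradient domination and linear convergence *)

Section PL.
Context {R : realType} {k l m p : nat} (P : sdp R k l m p).
Context (phi_convex : convex_on_sym (phi P)).
Context (phi_C1 : C1_on_sym (phi P)).
Context (Amx_sym : forall i, symmetric_mx (Amx P i)).

Lemma Aadj_sym lam : symmetric_mx (Aadj P lam).
Proof.
rewrite /symmetric_mx /Aadj linear_sum; apply: eq_bigr => i _ /=.
by rewrite linearZ /= Amx_sym.
Qed.

Lemma young (a u x : R) : 0 < a -> u * x <= a / 8 * x ^+ 2 + 2 / a * u ^+ 2.
Proof.
move=> a0; rewrite -subr_ge0.
have -> : a / 8 * x ^+ 2 + 2 / a * u ^+ 2 - u * x = a / 8 * (x - 4 / a * u) ^+ 2.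
  by field; rewrite gt_eqF.
by rewrite mulr_ge0 ?sqr_ge0// divr_ge0// ltW.
Qed.

(** The tolerance [th] on the slack matrix is such that its contribution
[c1 * th * X^2] is at most [alpha / 8 * X^2].  Young's inequality spends another
[alpha / 8] of each square, so that the squares add up to at most half of what
quadratic growth provides, and the gap absorbs them. *)
Lemma gradient_dominated {r : nat} (zs : 'M[R]_(l, r) * 'cV[R]_p) (alpha eps : R) :
  (k <= r)%N -> 0 < alpha -> 0 < eps ->
  LICQ P zs -> stationary00 P zs -> quadratic_growth P alpha eps zs ->
  exists eta c : R, [/\ 0 < eta, 0 < c & \forall z \near zs,
    Omega P r z -> supp z.2 = supp zs.2 -> pnorm (rgrad P z) < eta ->
    fr P zs <= fr P z <= fr P zs + c * pnorm (rgrad P z) ^+ 2].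
Proof.
move=> kr a0 eps0 licq [Os gs0 psdS _] [rk0 growth].
have [dM [c1 [dM0 c10 HM]]] := fdot_slack_bound kr zs.1 rk0.
have [dy [c2 [dy0 c20 Hy]]] := fdot_square_bound zs.2.
pose th := alpha / (8 * (c1 + 1)).
have th0 : 0 < th by rewrite divr_gt0// mulr_gt0// ltr_wpDl.
have [eta eta0 hS] := slackM_near P phi_C1 zs th licq gs0 th0.
exists eta, ((c1 ^+ 2 + c2 ^+ 2) / alpha + 1); split=> //.
  by rewrite ltr_wpDl// divr_ge0 ?addr_ge0 ?sqr_ge0// ltW.
near=> z => Oz sz geta.
have [d1 d2 _ _] : [/\ fnorm (z.1 - zs.1) < eps, fnorm (z.2 - zs.2) < eps,
    fnorm (Cmx P z - Cmx P zs) < eps & fnorm (cvec P z - cvec P zs) < eps].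
  by near: z; exact: near_gradient.
have [d1' _ _ _] : [/\ fnorm (z.1 - zs.1) < dM, fnorm (z.2 - zs.2) < dM,
    fnorm (Cmx P z - Cmx P zs) < dM & fnorm (cvec P z - cvec P zs) < dM].
  by near: z; exact: near_gradient.
have [_ d2' _ _] : [/\ fnorm (z.1 - zs.1) < dy, fnorm (z.2 - zs.2) < dy,
    fnorm (Cmx P z - Cmx P zs) < dy & fnorm (cvec P z - cvec P zs) < dy].
  by near: z; exact: near_gradient.
have Sth : fnorm (slackM P z - slackM P zs) <= th by move: geta; near: z.
have G : fr P zs + alpha / 2 * (fnorm (gram (k := k) z.1 - gram zs.1) ^+ 2 +
    fnorm (hadamard z.2 z.2 - hadamard zs.2 zs.2) ^+ 2) <= fr P z.
  by have := growth z Oz sz; rewrite gt_max d1 d2 => /(_ isT).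
have gap := fr_gap_le P phi_convex phi_C1 z zs (lagmult P z) Oz Os.
set S := Cmx P z - _ in gap; rewrite -/(slackv P z) in gap.
have psd_near q (W : 'M[R]_(l, q)) :
    - (th * fnorm W ^+ 2) <= fdot (Jmx *m S *m Jmx^T) (W *m W^T).
  rewrite -slackME -[slackM P z](subrK (slackM P zs)) fdotDl.
  apply: (@le_trans _ _ (fdot (slackM P z - slackM P zs) (W *m W^T))); last first.
    by rewrite lerDl fdot_psd_gram.
  apply: le_trans (fdot_ge_fnorm _ _); rewrite lerN2.
  apply: ler_pM; rewrite ?fnorm_ge0//.
  by apply: le_trans (fnormM _ _) _; rewrite fnorm_tr expr2.
have SS : S^T = S by rewrite /S linearB /= Cmx_sym// Aadj_sym.
have bM := HM z.1 d1' S th SS (ltW th0) psd_near _ erefl.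
have hby := Hy z.2 d2' sz (slackv P z) _ erefl.
set g := pnorm _.
have g1 : fnorm (Jmx *m S *m hat z.1) <= g / 2.
  have := fnorm_fst_le_pnorm (rgrad P z); rewrite -/g rgradE//= fnormZ normr_nat -/S.
  by rewrite mulrC -ler_pdivlMr.
have g2 : fnorm (hadamard (slackv P z) z.2) <= g / 2.
  have := fnorm_snd_le_pnorm (rgrad P z); rewrite -/g rgradE//= fnormZ normr_nat.
  by rewrite mulrC -ler_pdivlMr.
have X0 := fnorm_ge0 (gram (k := k) z.1 - gram zs.1).
have Y0 := fnorm_ge0 (hadamard z.2 z.2 - hadamard zs.2 zs.2).
move: (fnorm (gram z.1 - _)) (fnorm (hadamard z.2 z.2 - _)) X0 Y0 G bM hby.
move=> X Y X0 Y0 G bM bY.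
move: (fdot S _) (fdot (slackv P z) _) bM bY gap => sX sY bM bY gap.
have T1 : c1 * (fnorm (Jmx *m S *m hat z.1) * X) <= (c1 * g / 2) * X.
  have -> : c1 * g / 2 * X = c1 * (g / 2 * X) by ring.
  by rewrite ler_wpM2l// ler_wpM2r.
have T2 : c2 * (fnorm (hadamard (slackv P z) z.2) * Y) <= (c2 * g / 2) * Y.
  have -> : c2 * g / 2 * Y = c2 * (g / 2 * Y) by ring.
  by rewrite ler_wpM2l// ler_wpM2r.
have T3 : c1 * (th * X ^+ 2) <= alpha / 8 * X ^+ 2.
  rewrite mulrA ler_wpM2r ?sqr_ge0//.
  have -> : alpha / 8 = (c1 + 1) * th by rewrite /th; field; rewrite gt_eqF// ltr_wpDl.
  by rewrite ler_wpM2r ?(ltW th0)// lerDl.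
have Y1 := young alpha (c1 * g / 2) X a0.
have Y2 := young alpha (c2 * g / 2) Y a0.
have T4 : 2 / alpha * (c1 * g / 2) ^+ 2 + 2 / alpha * (c2 * g / 2) ^+ 2 =
   (c1 ^+ 2 + c2 ^+ 2) / alpha * g ^+ 2 / 2 by field; rewrite gt_eqF.
have Xp : 0 <= alpha * X ^+ 2 by rewrite mulr_ge0 ?sqr_ge0// ltW.
have Yp : 0 <= alpha * Y ^+ 2 by rewrite mulr_ge0 ?sqr_ge0// ltW.
have g0 : 0 <= g ^+ 2 by exact: sqr_ge0.
rewrite mulrDr in bM.
move: ((c1 ^+ 2 + c2 ^+ 2) / alpha) T4 => K T4.
apply/andP; split; first by move: G Xp Yp; lra.
by move: G bM bY gap T1 T2 T3 Y1 Y2 T4 Xp Yp g0; lra.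
Unshelve. all: by end_near. Qed.

End PL.

Lemma geometric_decay {R : realType} (e : nat -> R) (q : R) (M : nat) :
  0 < q -> (forall i, (M <= i)%N -> e i.+1 <= q * e i) ->
  forall i, (M <= i)%N -> e i <= (e M / q ^+ M) * q ^+ i.
Proof.
move=> q0 he i /subnK <-; elim: (i - M)%N => [|j IH].
  by rewrite add0n divfK// gt_eqF// exprn_gt0.
rewrite addSn exprS mulrCA; apply: le_trans (he _ (leq_addl _ _)) _.
by rewrite ler_wpM2l// ltW.
Qed.

Theorem theorem2 (R : realType) (k l m p : nat) (P : sdp R k l m p)
  (hphi_convex : convex_on_sym (phi P))
  (hphi_C1 : C1_on_sym (phi P))
  (hA : forall i, symmetric_mx (Amx P i))
  (rbar : nat) (hLICQ : LICQ_assumption P rbar)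
  (prm : params R l p) (hprm : params_ok P rbar prm)
  (z : nat -> iterate R l p) (hz : generated P rbar prm z)
  (r : nat) (hr : (rbar <= r <= k + l)%N)
  (hlip : [locally [lipschitz rgrad P w | w in Omega P r]])
  (zstar : 'M[R]_(l, r) * 'cV[R]_p) (alpha eps : R)
  (h_alpha : 0 < alpha) (h_eps : 0 < eps)
  (h_cvg : (fun i => at_rank r (z i)) @ \oo --> zstar)
  (h_stat : stationary00 P zstar)
  (h_growth : quadratic_growth P alpha eps zstar)
  (gamma : R) (h_gamma : 0 < gamma)
  (N : nat) (hN : (0 < N)%N)
  (h_tail : forall i, (N <= i)%N ->
     [/\ eps_i prm i = 0, in_Omega P r (z i), supp (pt (z i)).2 = supp zstar.2 &
         fr P (at_rank r (z i.+1)) - fr P (at_rank r (z i)) <=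
         - gamma * pnorm (rgrad P (at_rank r (z i))) *
           Num.min 1 (pnorm (rgrad P (at_rank r (z i))))]) :
  exists a q : R, [/\ 0 <= a, 0 <= q < 1 &
    \forall i \near \oo,
      `|fr P (at_rank r (z i)) - fr P zstar| <= a * q ^+ i].
Proof.
have [_ kr hL] := hLICQ; have /andP[rr _] := hr; have [Os _ _ _] := h_stat.
have licq : LICQ P zstar by apply: (hL r rr).2.
have [eta [c [eta0 c0 hPL]]] := gradient_dominated P hphi_convex hphi_C1 hA zstar
  alpha eps (leq_trans kr rr) h_alpha h_eps licq h_stat h_growth.
pose w i := at_rank r (z i).
pose e i := fr P (w i) - fr P zstar.
pose g i := pnorm (rgrad P (w i)).
(* Below [1] the minimum in the decrease condition is the gradient norm, and
   below [eta] gradient domination applies. *)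
pose et := Num.min 1 eta.
have et0 : 0 < et by rewrite lt_min ltr01.
have g0 i : 0 <= g i by exact: sqrtr_ge0.
have hN' : \forall i \near \oo, (N <= i)%N by exists N.
have small : \forall i \near \oo, `|e i| < gamma * et ^+ 2 / 2.
  have fc : (fun i => fr P (w i)) @ \oo --> fr P zstar.
    apply: (cvg_comp _ (fr P) h_cvg).
    exact/differentiable_continuous/differentiable_fr.
  have b0 : 0 < gamma * et ^+ 2 / 2 by rewrite divr_gt0// mulr_gt0// exprn_gt0.
  by move/cvgrPdistC_lt: fc => /(_ _ b0).
have tail : \forall i \near \oo, 0 <= e i <= c * g i ^+ 2 /\
    e i.+1 <= e i - gamma * g i ^+ 2.
  have small' : \forall i \near \oo, `|e i.+1| < gamma * et ^+ 2 / 2.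
    by case: small => M _ hM; exists M => // i /= Mi; apply: hM => /=; exact: leqW.
  near=> i.
  have Ni : (N <= i)%N by near: i.
  have [_ [_ Oi] si di] := h_tail i Ni.
  (* A gradient of norm at least [et] would force a decrease of
     [gamma * et ^+ 2], more than two consecutive gaps allow. *)
  have get : g i < et.
    rewrite ltNge; apply/negP => etg.
    have h1 : et <= Num.min 1 (g i) by rewrite le_min etg ge_min lexx.
    have : gamma * et ^+ 2 <= gamma * g i * Num.min 1 (g i).
      rewrite expr2 mulrA.
      by rewrite ler_pM ?mulr_ge0 ?(ltW h_gamma) ?(ltW et0)// ler_wpM2l ?(ltW h_gamma).
    have s1 : `|e i| < gamma * et ^+ 2 / 2 by near: i.
    have s2 : `|e i.+1| < gamma * et ^+ 2 / 2 by near: i.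
    move: di s1 s2; rewrite -/(w i) -/(w i.+1) -/(g i) !ltr_norml /e.
    by move=> di /andP[? ?] /andP[? ?]; lra.
  move: get; rewrite lt_min => /andP[g1 geta].
  have : Omega P r (w i) -> supp (w i).2 = supp zstar.2 ->
     pnorm (rgrad P (w i)) < eta ->
     fr P zstar <= fr P (w i) <= fr P zstar + c * pnorm (rgrad P (w i)) ^+ 2.
    by near: i; exact: (h_cvg _ hPL).
  move=> /(_ Oi si geta); rewrite -/(g i) => /andP[f1 f2]; split.
    by rewrite /e subr_ge0 f1 lerBlDl.
  move: di; rewrite -/(w i) -/(w i.+1) -/(g i) (min_idPr (ltW g1)) /e expr2.
  by lra.
(* The denominator is [c + gamma] and not [c] to keep [q] positive, as the
   prefactor [e M / q ^+ M] requires. *)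
pose q := 1 - gamma / (c + gamma).
have cg : 0 < c + gamma by rewrite addr_gt0.
have qE : q = c / (c + gamma) by rewrite /q; field; rewrite gt_eqF.
have q0 : 0 < q by rewrite qE divr_gt0.
have q1 : q < 1 by rewrite /q ltrBlDr ltrDl divr_gt0.
have [M _ hM] := tail.
have eM0 : 0 <= e M by have [/andP[]] := hM M (leqnn M).
exists (e M / q ^+ M), q; split.
- by rewrite divr_ge0// exprn_ge0// ltW.
- by rewrite (ltW q0).
- exists M => // i /= Mi; have [/andP[ei0 _] _] := hM i Mi.
  rewrite ger0_norm//; apply: geometric_decay => // j Mj.
  have [/andP[ej0 ejc] ej] := hM j Mj.
  apply: le_trans ej _; rewrite /q mulrBl mul1r lerD2l lerN2.
  have : e j <= (c + gamma) * g j ^+ 2.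
    by apply: le_trans ejc _; rewrite ler_wpM2r ?sqr_ge0// lerDl ltW.
  rewrite -ler_pdivrMl// => h.
  by rewrite -mulrA ler_wpM2l// ltW.
Unshelve. all: by end_near. Qed.
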